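(* For $n\ge1$ let $K_n$ be the Markov kernel of the simple random walk on the discrete hypercube $\{0,1\}^n$, i.e. $K_n(x,y)=\frac1n$ if $x$ and $y$ differ in exactly one coordinate and $K_n(x,y)=0$ otherwise. Then $\mathrm{Ric}(K_n)\ge\frac2n$.
   Context: $\mathbb R_+=[0,\infty)$. Let $K$ be a Markov kernel on a finite set $\mathcal X$ ($\sum_yK(x,y)=1$ for all $x$) which is irreducible and reversible with respect to its unique stationary probability measure $\pi$ ($K(x,y)\pi(x)=K(y,x)\pi(y)$). Probability densities: $\mathscr P(\mathcal X)=\{\rho:\mathcal X\to\mathbb R_+ : \sum_x\pi(x)\rho(x)=1\}$. Logarithmic mean: $\theta(s,t)=\int_0^1s^{1-p}t^p\,dp$ for $s,t\ge0$ (equal to $0$ if $s=0$ or $t=0$). For a density $\rho$ write $\hat\rho(x,y)=\theta(\rho(x),\rho(y))$. Metric $\mathcal W$: for $\bar\rho_0,\bar\rho_1\in\mathscr P(\mathcal X)$, $$\mathcal W(\bar\rho_0,\bar\rho_1)^2=\inf\int_0^1\frac12\sum_{x,y}(\psi_t(y)-\psi_t(x))^2\hat\rho_t(x,y)K(x,y)\pi(x)\,dt,$$ where the infimum runs over pairs $(\rho,\psi)$ with $\rho:[0,1]\to\mathbb R^{\mathcal X}$ of class $C^\infty$, $\rho_t\in\mathscr P(\mathcal X)$ for all $t$, $\rho_0=\bar\rho_0$, $\rho_1=\bar\rho_1$, $\psi:[0,1]\to\mathbb R^{\mathcal X}$ measurable, and $\dot\rho_t(x)+\sum_y(\psi_t(y)-\psi_t(x))\hat\rho_t(x,y)K(x,y)=0$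 for all $x\in\mathcal X$, $t\in(0,1)$. Entropy: $\mathcal H(\rho)=\sum_x\pi(x)\rho(x)\log\rho(x)$ (with $0\log0=0$). A constant speed geodesic is a curve $(\rho_t)_{t\in[0,1]}$ in $\mathscr P(\mathcal X)$ with $\mathcal W(\rho_s,\rho_t)=|s-t|\mathcal W(\rho_0,\rho_1)$ for all $s,t\in[0,1]$. $\mathrm{Ric}(K)\ge\kappa$ (non-local Ricci curvature bounded below by $\kappa\in\mathbb R$) means: for every constant speed geodesic $(\rho_t)_{t\in[0,1]}$ in $(\mathscr P(\mathcal X),\mathcal W)$ and every $t\in[0,1]$, $\mathcal H(\rho_t)\le(1-t)\mathcal H(\rho_0)+t\mathcal H(\rho_1)-\frac\kappa2t(1-t)\mathcal W(\rho_0,\rho_1)^2$. *)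

(* Defs.v *)
From HB Require Import structures.
From mathcomp Require Import all_boot all_order all_algebra.
From mathcomp Require Import all_classical all_reals all_analysis.

Set Implicit Arguments.
Unset Strict Implicit.
Unset Printing Implicit Defensive.

Import Order.TTheory GRing.Theory Num.Theory.
Import numFieldNormedType.Exports.

Local Open Scope classical_set_scope.
Local Open Scope ring_scope.

Definition is_markov_kernel (R : realType) (X : finType) (K : X -> X -> R) :=
  (forall x y, 0 <= K x y) /\ (forall x, \sum_y K x y = 1).

Definition is_irreducible (R : realType) (X : finType) (K : X -> X -> R) :=
  forall x y, connect (fun a b => 0 < K a b) x y.

Definition is_stationary (R : realType) (X : finType) (K : X -> X -> R)
    (pi : X -> R) :=
  [/\ forall x, 0 <= pi x, \sum_x pi x = 1 &
      forall y, \sum_x pi x * K x y = pi y].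

Definition is_reversible (R : realType) (X : finType) (K : X -> X -> R)
    (pi : X -> R) :=
  forall x y, K x y * pi x = K y x * pi y.

Definition is_density (R : realType) (X : finType) (pi rho : X -> R) :=
  (forall x, 0 <= rho x) /\ \sum_x pi x * rho x = 1.

(* The library convention 0 `^ 0 = 1 matters only at an endpoint of [0, 1],
   so the integral vanishes as soon as s = 0 or t = 0. *)
Definition logmean (R : realType) (s t : R) : R :=
  Rintegral (@lebesgue_measure R) `[0, 1] (fun p => s `^ (1 - p) * t `^ p).

Definition hat (R : realType) (X : finType) (rho : X -> R) (x y : X) : R :=
  logmean (rho x) (rho y).

(* C^oo on the closed interval, with one-sided derivatives at 0 and 1: D k is
   the k-th derivative of f on [0, 1].  Values of f outside [0, 1] are
   irrelevant. *)
Definition smooth01 (R : realType) (f : R -> R) :=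
  exists D : nat -> R -> R,
    (forall t : R, 0 <= t <= 1 -> D 0%N t = f t) /\
    (forall (k : nat) (t : R), 0 <= t <= 1 ->
       h^-1 * (D k (t + h) - D k t)
         @[h --> within [set h | 0 <= t + h <= 1] 0^'] --> D k.+1 t).

Definition action (R : realType) (X : finType) (K : X -> X -> R) (pi : X -> R)
    (rho psi : X -> R) : R :=
  2^-1 * \sum_x \sum_y
    (psi y - psi x) ^+ 2 * hat rho x y * K x y * pi x.

(* The curves on [0, 1] are represented by functions on R whose values outside
   [0, 1] are irrelevant. *)
Definition admissible (R : realType) (X : finType) (K : X -> X -> R)
    (pi : X -> R) (rho0 rho1 : X -> R) (rho psi : R -> X -> R) :=
  [/\ forall x, smooth01 (rho ^~ x),
      forall t : R, 0 <= t <= 1 -> is_density pi (rho t),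
      rho 0 = rho0 /\ rho 1 = rho1,
      forall x, measurable_fun `[0 : R, 1] (psi ^~ x) &
      forall (t : R) (x : X), 0 < t < 1 ->
        derive1 (rho ^~ x) t
          + \sum_y (psi t y - psi t x) * hat (rho t) x y * K x y = 0].

(* Extended-real valued: an infimum over the empty set would be +oo. *)
Definition W2 (R : realType) (X : finType) (K : X -> X -> R) (pi : X -> R)
    (rho0 rho1 : X -> R) : \bar R :=
  ereal_inf [set c : \bar R | exists rho psi,
    admissible K pi rho0 rho1 rho psi /\
    c = (\int[lebesgue_measure]_(t in `[0%R : R, 1%R])
           (action K pi (rho t) (psi t))%:E)%E].

Definition W (R : realType) (X : finType) (K : X -> X -> R) (pi : X -> R)
    (rho0 rho1 : X -> R) : \bar R :=
  sqrte (W2 K pi rho0 rho1).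

(* The library sets ln 0 = 0, whence 0 * ln 0 = 0. *)
Definition entropy (R : realType) (X : finType) (pi rho : X -> R) : R :=
  \sum_x pi x * (rho x * ln (rho x)).

Definition is_geodesic (R : realType) (X : finType) (K : X -> X -> R)
    (pi : X -> R) (rho : R -> X -> R) :=
  (forall t : R, 0 <= t <= 1 -> is_density pi (rho t)) /\
  (forall s t : R, 0 <= s <= 1 -> 0 <= t <= 1 ->
     W K pi (rho s) (rho t) = (`|s - t|%:E * W K pi (rho 0%R) (rho 1%R))%E).

(* Ric(K) >= kappa, where pi is the stationary distribution of K. *)
Definition Ric_ge (R : realType) (X : finType) (K : X -> X -> R) (pi : X -> R)
    (kappa : R) :=
  forall rho : R -> X -> R, is_geodesic K pi rho ->
  forall t : R, 0 <= t <= 1 ->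
    ((entropy pi (rho t))%:E <=
       ((1 - t) * entropy pi (rho 0%R) + t * entropy pi (rho 1%R))%:E
       - (kappa / 2 * t * (1 - t))%:E * W K pi (rho 0%R) (rho 1%R) ^+ 2)%E.

Definition hypercube (n : nat) : finType := {ffun 'I_n -> bool}.

Definition hypercube_kernel (R : realType) (n : nat) (x y : hypercube n) : R :=
  if #|[pred i | x i != y i]| == 1%N then n%:R^-1 else 0.

Definition hypercube_unif (R : realType) (n : nat) (x : hypercube n) : R :=
  #|hypercube n|%:R^-1.

Definition flip (n : nat) (x : hypercube n) (i : 'I_n) : hypercube n :=
  [ffun j => (i == j) (+) x j].

Lemma hypercube_kernelC (R : realType) n (x y : hypercube n) :
  hypercube_kernel R x y = hypercube_kernel R y x.
Proof.
rewrite /hypercube_kernel.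
have -> // : #|[pred i | x i != y i]| = #|[pred i | y i != x i]|.
by apply: fintype.eq_card => i; rewrite !inE eq_sym.
Qed.

Lemma flip_neq n (x : hypercube n) i j : (x j != flip x i j) = (j == i).
Proof. by rewrite ffunE [j == i]eq_sym; case: (i == j); case: (x j). Qed.

Lemma kernel_flip (R : realType) n (x : hypercube n) i :
  hypercube_kernel R x (flip x i) = n%:R^-1.
Proof.
rewrite /hypercube_kernel.
have -> : #|[pred j | x j != flip x i j]| = #|pred1 i|.
  by apply: fintype.eq_card => j; rewrite !inE flip_neq.
by rewrite card1.
Qed.

Lemma flip_inj n (x : hypercube n) : injective (flip x).
Proof.
move=> i j e; have := flip_neq x i i.
by rewrite e flip_neq eqxx => /eqP.
Qed.

Lemma hypercube_kernel_markov (R : realType) n : (0 < n)%N ->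
  is_markov_kernel (@hypercube_kernel R n).
Proof.
move=> n0; split=> [x y|x].
  by rewrite /hypercube_kernel; case: ifP; rewrite ?invr_ge0.
rewrite (bigID (mem (codom (flip x)))) /= [X in _ + X]big1 => [|y]; last first.
  rewrite /hypercube_kernel; case: ifP => // /fintype.card1P[i yx] /negP[].
  apply/codomP; exists i; apply/ffunP => j.
  have := yx j; rewrite !inE ffunE eq_sym [j == i]eq_sym => <-.
  by case: (x j); case: (y j).
rewrite addr0 (eq_bigl (mem (codom (flip x)))) // -big_uniq /=; last first.
  by rewrite map_inj_uniq ?enum_uniq //; exact: flip_inj.
rewrite big_map big_enum /= (eq_bigr (fun=> n%:R^-1)) => [|i _].
  by rewrite sumr_const card_ord -(mulr_natr _^-1) mulVf // pnatr_eq0 -lt0n.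
exact: kernel_flip.
Qed.

Lemma hypercube_kernel_irreducible (R : realType) n :
  is_irreducible (@hypercube_kernel R n).
Proof.
move=> x y; have [m] := ubnP #|[pred i | x i != y i]|.
elim: m x => // m IH x lem.
have [/pred0P e|] := boolP (pred0b [pred i | x i != y i]).
  suff -> : x = y by exact: connect0.
  by apply/ffunP => i; have /= /negbFE/eqP := e i.
case/pred0Pn => i /= xyi.
have n0 : (0 < n)%N := leq_ltn_trans (leq0n i) (ltn_ord i).
apply: (@connect_trans _ _ (flip x i)).
  by apply: connect1; rewrite kernel_flip invr_gt0 ltr0n.
rewrite ltnS in lem; apply: IH; apply: leq_trans lem.
rewrite [X in (_ <= X)%N](cardD1 i) inE xyi add1n ltnS.
apply: subset_leq_card; apply/fintype.subsetP => j; rewrite !inE ffunE.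
have [<-|ij] := eqVneq i j; last by rewrite addFb => ->.
by move: xyi; case: (x i); case: (y i).
Qed.

Lemma hypercube_unif_reversible (R : realType) n :
  is_reversible (@hypercube_kernel R n) (@hypercube_unif R n).
Proof. by move=> x y; rewrite hypercube_kernelC. Qed.

Lemma hypercube_unif_stationary (R : realType) n : (0 < n)%N ->
  is_stationary (@hypercube_kernel R n) (@hypercube_unif R n).
Proof.
move=> n0; split=> [x||y]; first by rewrite invr_ge0.
  rewrite sumr_const -(mulr_natr _^-1) mulVf // pnatr_eq0 -lt0n.
  by apply/card_gt0P; exists [ffun=> false].
rewrite -mulr_sumr (eq_bigr (@hypercube_kernel R n y)) => [|x _].
  by rewrite (hypercube_kernel_markov R n0).2 mulr1.
exact: hypercube_kernelC.
Qed.

(* Main.v *)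
Require Import Defs.
From HB Require Import structures.
From mathcomp Require Import all_boot all_order all_algebra.
From mathcomp Require Import all_classical all_reals all_analysis.
From mathcomp Require Import measurable_realfun ring lra.

(* The heat semigroup P of the hypercube commutes with every coordinate flip, so
   it maps a flux c, odd under flips, with divergence V to a flux with
   divergence P_r V.  Along direction i the oddness of c_i produces a factor
   exp (-2r/n); along the other directions P averages, and the concavity of the
   logarithmic mean keeps the energy from growing.  Hence P_r contracts the
   Riemannian norm behind W by exp (-2r/n), without any computation of the
   Hessian of the entropy.

   Since the heat flow is the gradient flow of the entropy H, expanding the
   energy of u |-> P_(s u) rho_(tau u), where k = 2s/n and
   tau u = (u + k u^2) / (1 + k), gives the evolution variational inequality
     W(m0, P_s m1)^2 <= W(m0, m1)^2 / (1 + k) + 2 s (H m0 - H (P_s m1)).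
   For a geodesic rho apply it to (rho_0, rho_t) and (rho_1, rho_t), combine
   the two with
     t (1-t) W(rho_0, rho_1)^2 <= (1-t) W(rho_0, m)^2 + t W(rho_1, m)^2
   for m = P_s rho_t, and let s tend to 0. *)

Set Implicit Arguments.
Unset Strict Implicit.
Unset Printing Implicit Defensive.

Import Order.TTheory GRing.Theory Num.Theory.
Import numFieldNormedType.Exports.

Local Open Scope classical_set_scope.
Local Open Scope ring_scope.

(** * Smooth functions on the unit interval *)

(** Geodesics are a purely metric notion here: they may run along the boundary of the simplex, where
    the logarithmic mean vanishes and the entropy is not differentiable, so nothing is
    differentiated along them. The variational inequality only uses almost minimizing smooth curves,
    and the heat flow makes these positive at every time after the initial one, so that potentials
    and logarithms are available. Almost minimizers need not have constant speed, so the gain exp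
    (-2 k u) cannot be integrated apart from the energy. A reparametrization with tau' proportional
    to exp (2 k u) would make (tau')^2 exp (-2 k u) a constant multiple of tau', which a
    substitution integrates. Only the first order in k survives as s tends to 0, so the truncation 1
    + 2 k u of the exponential is good enough and keeps tau polynomial; its integral over [0, 1] is
    the constant 1 + k. As W is an infimum over globally smooth curves, even the triangle inequality
    is not immediate: curves must come to rest to infinite order before they are joined, whence the
    flat functions. *)

Section Smooth.
Variable R : realType.
Implicit Types (f g : R -> R) (t : R).

Definition I01 : set R := [set v | 0 <= v <= 1].

(* Carathéodory's form of the derivative: the difference quotient extends
   continuously, which makes the chain rule immediate. *)
Definition D01 f f' := forall t, I01 t -> exists phi : R -> R,
  (forall v, I01 v -> f v - f t = phi v * (v - t)) /\
  phi v @[v --> within I01 (nbhs t)] --> f' t.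

Lemma D01P f f' : D01 f f' <->
  forall t, 0 <= t <= 1 -> h^-1 * (f (t + h) - f t)
    @[h --> within [set h | 0 <= t + h <= 1] 0^'] --> f' t.
Proof.
split=> [Df t It|Df t It].
  have [phi [fphi cphi]] := Df t It.
  apply/cvgrPdist_lt => e e0.
  move/cvgrPdist_lt : cphi => /(_ e e0).
  rewrite !near_withinE => /nbhs_ballP[d /= d0 dP].
  apply/nbhs_ballP; exists d => //= h hd h0 Ith.
  rewrite fphi // addrAC subrr add0r mulrC mulfK //.
  apply: (dP (t + h)) => //.
  move: hd; rewrite /ball /= sub0r normrN => hd.
  by rewrite opprD addNKr normrN.
exists (fun v => if v == t then f' t else (v - t)^-1 * (f v - f t)).
split=> [v Iv|].
  have [->|vt] := eqVneq v t; first by rewrite !subrr mulr0.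
  by rewrite mulrC mulVKf // subr_eq0.
apply/cvgrPdist_lt => e e0.
move/cvgrPdist_lt : (Df t It) => /(_ e e0).
rewrite !near_withinE => /nbhs_ballP[d /= d0 dP].
apply/nbhs_ballP; exists d => //= v vd Iv.
have [//|vt] := eqVneq v t; first by rewrite subrr normr0.
have := dP (v - t); rewrite subrKC; apply => //.
  by move: vd; rewrite /ball /= sub0r normrN distrC.
by rewrite subr_eq0.
Qed.

Lemma cvg_I01 t : v @[v --> within I01 (nbhs t)] --> t.
Proof. exact: cvg_within. Qed.

Lemma D01_cvg f f' t : D01 f f' -> I01 t ->
  f v @[v --> within I01 (nbhs t)] --> f t.
Proof.
move=> Df It; have [phi [fphi cphi]] := Df t It.
have h : (f t + phi v * (v - t)) @[v --> within I01 (nbhs t)] --> f t.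
  rewrite -[X in _ --> X]addr0; apply: cvgD; first exact: cvg_cst.
  rewrite -[X in _ --> X](mulr0 (f' t)) -(subrr t).
  by apply: cvgM => //; apply: cvgB; [exact: cvg_I01|exact: cvg_cst].
apply: cvg_trans h; apply: near_eq_cvg.
by rewrite near_withinE; near=> v => Iv; rewrite -fphi // subrKC.
Unshelve. all: by end_near. Qed.

Lemma D01_within f f' : D01 f f' -> {within `[0 : R, 1], continuous f}.
Proof.
move=> Df; apply/subspace_continuousP => t It.
have I01E : `[0 : R, 1]%classic = I01.
  by apply/seteqP; split => v /=; rewrite in_itv.
by rewrite I01E in It *; exact: D01_cvg Df It.
Qed.

Lemma D01_cst c : D01 (fun=> c) (fun=> 0).
Proof.
move=> t _; exists (fun=> 0); split=> [v _|]; last exact: cvg_cst.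
by rewrite subrr mul0r.
Qed.

Lemma D01_id : D01 id (fun=> 1).
Proof.
move=> t _; exists (fun=> 1); split=> [v _|]; last exact: cvg_cst.
by rewrite mul1r.
Qed.

Lemma D01_add f g f' g' : D01 f f' -> D01 g g' ->
  D01 (fun t => f t + g t) (fun t => f' t + g' t).
Proof.
move=> Df Dg t It.
have [p [fp cp]] := Df t It; have [q [gq cq]] := Dg t It.
exists (fun v => p v + q v); split=> [v Iv|]; last exact: cvgD.
by rewrite mulrDl -fp // -gq //; ring.
Qed.

Lemma D01_mul f g f' g' : D01 f f' -> D01 g g' ->
  D01 (fun t => f t * g t) (fun t => f' t * g t + f t * g' t).
Proof.
move=> Df Dg t It.
have [p [fp cp]] := Df t It; have [q [gq cq]] := Dg t It.
exists (fun v => p v * g v + f t * q v); split=> [v Iv|].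
  by rewrite mulrDl -mulrA [g v * _]mulrC mulrA -fp // -mulrA -gq //; ring.
apply: cvgD; first by apply: cvgM => //; exact: D01_cvg Dg It.
by apply: cvgM => //; exact: cvg_cst.
Qed.

Lemma D01_comp f a f' a' : D01 f f' -> D01 a a' ->
  (forall t, I01 t -> I01 (a t)) ->
  D01 (fun t => f (a t)) (fun t => f' (a t) * a' t).
Proof.
move=> Df Da aI t It.
have [p [fp cp]] := Df (a t) (aI t It); have [q [aq cq]] := Da t It.
exists (fun v => p (a v) * q v); split=> [v Iv|].
  by rewrite -mulrA -aq // -fp //; exact: aI.
apply: cvgM => //.
apply: (@cvg_comp _ _ _ a p _ (within I01 (nbhs (a t)))) => //.
move=> A; rewrite /= !/nbhs /= => At.
have := D01_cvg Da It.
rewrite /within /= in At *.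
move=> /(_ _ At); rewrite /= /nbhs/= /within /=.
by apply: filterS => v h Iv; apply: h => //; exact: aI.
Qed.

Lemma D01_ext f g f' g' : (forall t, I01 t -> f t = g t) ->
  (forall t, I01 t -> f' t = g' t) -> D01 f f' -> D01 g g'.
Proof.
move=> fg fg' Df t It; have [p [fp cp]] := Df t It.
by exists p; split=> [v Iv|]; rewrite -?fg -?fg' // fp.
Qed.

Lemma is_derive_D01 f f' :
  (forall t : R, is_derive t (1 : R) f (f' t)) -> D01 f f'.
Proof.
move=> df; apply/D01P => t It.
have [dft <-] := df t.
have := @derivable1_diffP.
have h : (h^-1 * (f (t + h) - f t)) @[h --> 0^'] --> 'D_1 f t.
  have := dft; rewrite /derivable => /cvg_ex[l Hl].
  have -> : 'D_1 f t = l by apply/cvg_lim.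
  move: Hl; apply: cvg_trans; apply: near_eq_cvg; near=> h => /=.
  by rewrite /GRing.scale /= mulr1 (addrC h).
by move=> _; apply: cvg_trans h; apply: cvg_app; exact: cvg_within.
Unshelve. all: by end_near. Qed.

Lemma D01_is_derive f f' t :
  D01 f f' -> 0 < t < 1 -> is_derive t (1 : R) f (f' t).
Proof.
move=> /D01P Df /andP[t0 t1].
have h : (h^-1 *: (f (h *: (1:R) + t) - f t)) @[h --> 0^'] --> f' t.
  have := Df t; rewrite !ltW // => /(_ isT).
  move=> + A At => /(_ A At); rewrite /nbhs /= /within /= => hA.
  have : \forall h \near 0^', 0 <= t + h <= 1.
    apply/nbhs_ballP => /=; exists (Num.min t (1 - t)).
      by rewrite /= lt_min t0 subr_gt0.
    move=> h; rewrite /ball/= sub0r normrN lt_min !ltr_norml.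
    by move=> /andP[/andP[a b] /andP[c d]] _; lra.
  move: hA; rewrite /nbhs /=; apply: filterS2 => h hA hI.
  by have := hA hI; rewrite /GRing.scale /= mulr1 [h + t]addrC.
split; last by apply/cvg_lim.
by apply/cvg_ex; exists (f' t).
Qed.

Lemma smooth01P f : smooth01 f <-> exists D : nat -> R -> R,
  (forall t, I01 t -> D 0%N t = f t) /\ forall k, D01 (D k) (D k.+1).
Proof.
split=> -[D [D0 DD]]; exists D; split => // k.
  by apply/D01P => t; exact: DD.
by have /D01P := DD k.
Qed.

(* Any family of functions whose derivatives lie in the algebra it generates
   consists of smooth functions; sums, products and compositions follow by
   taking for the family the iterated derivatives of the operands. *)
Inductive falg (G : (R -> R) -> Prop) : (R -> R) -> Prop :=
| falg_gen g : G g -> falg G g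
| falg_cst c : falg G (fun=> c)
| falg_add f g : falg G f -> falg G g -> falg G (fun t => f t + g t)
| falg_mul f g : falg G f -> falg G g -> falg G (fun t => f t * g t).

Lemma falg_smooth (G : (R -> R) -> Prop) :
  (forall g, G g -> exists2 g', falg G g' & D01 g g') ->
  forall f, falg G f -> smooth01 f.
Proof.
move=> GD.
have AD f : falg G f -> exists2 g, falg G g & D01 f g.
  elim=> {f}[g /GD//|c|f g Gf [f' Gf' Df] Gg [g' Gg' Dg]|
    f g Gf [f' Gf' Df] Gg [g' Gg' Dg]].
  - by exists (fun=> 0); [exact: falg_cst|exact: D01_cst].
  - by exists (fun t => f' t + g' t); [exact: falg_add|exact: D01_add].
  - exists (fun t => f' t * g t + f t * g' t); last exact: D01_mul.
    by apply: falg_add; exact: falg_mul.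
(* Choosing derivatives inside the algebra gives an operator [d], whose iterates form the sequence
   required by [smooth01]. *)
have /choice[d dP] : forall f, exists g, falg G f -> falg G g /\ D01 f g.
  move=> f; have [Gf|nG] := pselect (falg G f); last by exists f.
  by have [g Gg Dg] := AD f Gf; exists g.
move=> f Gf; apply/smooth01P; exists (fun k => iter k d f); split=> // k.
have : falg G (iter k d f) by elim: k => //= k /dP[].
by move=> /dP[_].
Qed.

Lemma smooth01_ext f g : (forall t, I01 t -> f t = g t) ->
  smooth01 f -> smooth01 g.
Proof.
move=> fg [D [D0 DD]]; exists D; split=> // t It.
by rewrite D0 // fg.
Qed.

Lemma smooth01_cst c : smooth01 (fun=> c : R).
Proof. by apply: (@falg_smooth (fun=> False)) => //; exact: falg_cst. Qed.

Lemma smooth01_id : smooth01 (@id R).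
Proof.
apply: (@falg_smooth (fun g => g = id)); last exact: falg_gen.
by move=> _ ->; exists (fun=> 1); [exact: falg_cst|exact: D01_id].
Qed.

Lemma smooth01_addmul f g : smooth01 f -> smooth01 g ->
  smooth01 (fun t => f t + g t) /\ smooth01 (fun t => f t * g t).
Proof.
move=> /smooth01P[D [D0 DD]] /smooth01P[E [E0 EE]].
pose G h := exists k, h = D k \/ h = E k.
have GD h : G h -> exists2 h', falg G h' & D01 h h'.
  move=> [k [->|->]]; [exists (D k.+1)|exists (E k.+1)] => //;
  by apply: falg_gen; exists k.+1; auto.
have GDk k : falg G (D k) by apply: falg_gen; exists k; left.
have GEk k : falg G (E k) by apply: falg_gen; exists k; right.
split; [apply: (smooth01_ext (f := fun t => D 0%N t + E 0%N t))|
        apply: (smooth01_ext (f := fun t => D 0%N t * E 0%N t))].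
- by move=> t It; rewrite D0 // E0.
- by apply: (falg_smooth GD); exact: falg_add.
- by move=> t It; rewrite D0 // E0.
- by apply: (falg_smooth GD); exact: falg_mul.
Qed.

Lemma smooth01_add f g : smooth01 f -> smooth01 g ->
  smooth01 (fun t => f t + g t).
Proof. by move=> sf sg; have [] := smooth01_addmul sf sg. Qed.

Lemma smooth01_mul f g : smooth01 f -> smooth01 g ->
  smooth01 (fun t => f t * g t).
Proof. by move=> sf sg; have [] := smooth01_addmul sf sg. Qed.

Lemma smooth01_opp f : smooth01 f -> smooth01 (fun t => - f t).
Proof.
move=> sf; apply: (smooth01_ext (f := fun t => -1 * f t)).
  by move=> t _; rewrite mulN1r.
by apply: smooth01_mul => //; exact: smooth01_cst.
Qed.

Lemma smooth01_comp f a : smooth01 f -> smooth01 a ->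
  (forall t, I01 t -> I01 (a t)) -> smooth01 (fun t => f (a t)).
Proof.
move=> /smooth01P[D [D0 DD]] /smooth01P[E [E0 EE]] aI.
pose G h := exists k, h = (fun t => D k (E 0%N t)) \/ h = E k.
have EI t : I01 t -> I01 (E 0%N t) by move=> It; rewrite E0 //; exact: aI.
have GD h : G h -> exists2 h', falg G h' & D01 h h'.
  move=> [k [->|->]].
    exists (fun t => D k.+1 (E 0%N t) * E 1%N t); last exact: D01_comp.
    apply: falg_mul; apply: falg_gen; first by exists k.+1; left.
    by exists 1%N; right.
  by exists (E k.+1) => //; apply: falg_gen; exists k.+1; right.
apply: (smooth01_ext (f := fun t => D 0%N (E 0%N t))).
  by move=> t It; rewrite E0 // D0 //; exact: aI.
by apply: (falg_smooth GD); apply: falg_gen; exists 0%N; left.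
Qed.

Lemma smooth01_expR c : smooth01 (fun t => expR (c * t)).
Proof.
apply: (@falg_smooth (fun g => g = fun t => expR (c * t))); last exact: falg_gen.
move=> _ ->; exists (fun t => c * expR (c * t)).
  by apply: falg_mul; [exact: falg_cst|exact: falg_gen].
apply: is_derive_D01 => t.
by apply: is_derive_eq; rewrite /GRing.scale/= !mulr1 mulrC.
Qed.

Lemma smooth01_D01 f : smooth01 f -> exists f', D01 f f' /\
  exists f'', D01 f' f''.
Proof.
move=> /smooth01P[D [D0 DD]]; exists (D 1%N); split; last by exists (D 2).
by apply: (D01_ext _ _ (DD 0%N)).
Qed.

(* The library instances are about sums and products in the ring of functions;
   these variants are about eta-expanded functions. *)
Lemma is_derB f g t a b : is_derive t (1 : R) f a -> is_derive t (1 : R) g b ->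
  is_derive t (1 : R) (fun x => f x - g x) (a - b).
Proof. by move=> df dg; exact: is_deriveB. Qed.

Lemma is_derD f g t a b : is_derive t (1 : R) f a -> is_derive t (1 : R) g b ->
  is_derive t (1 : R) (fun x => f x + g x) (a + b).
Proof. by move=> df dg; exact: is_deriveD. Qed.

Lemma is_derM f g t a b : is_derive t (1 : R) f a -> is_derive t (1 : R) g b ->
  is_derive t (1 : R) (fun x => f x * g x) (a * g t + f t * b).
Proof.
move=> df dg; apply: is_derive_eq (is_deriveM df dg) _.
by rewrite /GRing.scale/= addrC [g t * a]mulrC.
Qed.

Lemma is_derC c t : is_derive t (1 : R) (fun=> c : R) 0.
Proof. exact: is_derive_cst. Qed.

Lemma is_derZ c f t a : is_derive t (1 : R) f a ->
  is_derive t (1 : R) (fun x => c * f x) (c * a).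
Proof.
by move=> df; apply: is_derive_eq (is_derM (is_derC c t) df) _; rewrite mul0r add0r.
Qed.

Lemma is_derX f t a k : is_derive t (1 : R) f a ->
  is_derive t (1 : R) (fun x => f x ^+ k) (k%:R * f t ^+ k.-1 * a).
Proof.
move=> df; have := is_deriveX k df; rewrite exprfctE => h.
by apply: is_derive_eq h _.
Qed.

Lemma is_der_sum (I : Type) (r : seq I) (P : pred I) (F : I -> R -> R) dF t :
  (forall i, is_derive t (1 : R) (F i) (dF i)) ->
  is_derive t (1 : R) (fun x => \sum_(i <- r | P i) F i x)
    (\sum_(i <- r | P i) dF i).
Proof.
move=> dFi; elim: r => [|i r IH].
  rewrite (_ : (fun x => _) = fun=> 0) ?big_nil; first exact: is_derC.
  by apply/funext => x; rewrite big_nil.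
rewrite (_ : (fun x => _) = fun x =>
  (if P i then F i x else 0) + \sum_(i <- r | P i) F i x); last first.
  by apply/funext => x; rewrite big_cons; case: ifP; rewrite ?add0r.
apply: is_derive_eq (is_derD (a := if P i then dF i else 0) _ IH) _.
  by case: ifP => // _; exact: is_derC.
by rewrite big_cons; case: ifP; rewrite ?add0r.
Qed.

Lemma is_der_comp f g t a b :
  is_derive (g t) (1 : R) f a -> is_derive t (1 : R) g b ->
  is_derive t (1 : R) (fun x => f (g x)) (a * b).
Proof. by move=> df dg; exact: is_derive1_comp. Qed.

End Smooth.

(** * Flat functions built from exp (- eps / w) *)

Section Flat.
Variables (R : realType) (eps : R).
Hypothesis eps0 : 0 < eps.

(** [flatE 0] is the classical flat function. The powers of 1 / w are included so that the
    derivatives of the family are linear combinations of its members, as [falg_smooth] requires. *)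
Definition flatE k (w : R) : R :=
  if 0 < w then w^-1 ^+ k * expR (- (eps * w^-1)) else 0.

Lemma flatE_le0 k w : w <= 0 -> flatE k w = 0.
Proof. by rewrite /flatE leNgt => /negbTE ->. Qed.

(** Write exp (eps / w) as the (k+1)-st power of exp y with y = eps / ((k+1) w), and use exp y >=
    y. *)
Lemma flatE_bound k w : `|flatE k w| <= (k.+1%:R / eps) ^+ k.+1 * `|w|.
Proof.
have k0 : 0 < k.+1%:R / eps by rewrite divr_gt0.
have [w0|w0] := ltP 0 w; last first.
  by rewrite flatE_le0 // normr0 mulr_ge0 // exprn_ge0 // ltW.
rewrite /flatE w0 ger0_norm; last first.
  by rewrite mulr_ge0 ?expR_ge0 // exprn_ge0 // invr_ge0 ltW.
rewrite gtr0_norm // expRN -ler_pdivrMr // mulrAC -exprSr.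
rewrite ler_pdivrMr ?expR_gt0 //.
have -> : eps * w^-1 = k.+1%:R * ((k.+1%:R / eps)^-1 * w^-1).
  by rewrite invfM invrK; field; rewrite gt_eqF //= pnatr_eq0.
rewrite expRM_natl -exprMn lerXn2r ?nnegrE ?invr_ge0 ?(ltW w0) //.
  by rewrite mulr_ge0 ?expR_ge0 // ltW.
rewrite -ler_pdivrMl //.
by apply: le_trans (expR_ge1Dx _); rewrite lerDr.
Qed.

Lemma flatE_cvg0 k : flatE k w @[w --> (0 : R)] --> 0.
Proof.
have h : ((k.+1%:R / eps) ^+ k.+1 * `|w|) @[w --> (0 : R)] --> 0.
  rewrite -[X in _ --> X](mulr0 ((k.+1%:R / eps) ^+ k.+1)).
  apply: cvgM; first exact: cvg_cst.
  by rewrite -[X in _ --> X](@normr0 _ R); apply: cvg_norm; exact: cvg_id.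
apply/norm_cvg0P; apply: (squeeze_cvgr _ (cvg_cst 0) h).
by near=> w => /=; rewrite normr_ge0 flatE_bound.
Unshelve. all: by end_near. Qed.

Lemma is_derive_flatE k w : is_derive w (1 : R) (flatE k)
  (- k%:R * flatE k.+1 w + eps * flatE k.+2 w).
Proof.
have [w0|w0|->] := ltgtP w 0.
- rewrite !flatE_le0 1?ltW // !mulr0 addr0.
  apply: (@near_eq_is_derive _ _ _ (fun=> 0)).
  by near=> v; rewrite flatE_le0 // ltW //; near: v; exact: lt_nbhsl.
- apply: (@near_eq_is_derive R R R
    (fun v => v^-1 ^+ k * expR (- (eps * v^-1)))).
    by near=> v; rewrite /flatE ifT //; near: v; exact: lt_nbhsr.
  rewrite /flatE w0.
  have wn : w != 0 by rewrite gt_eqF.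
  have dV : is_derive w (1:R) (fun v => v^-1) (- w ^- 2).
    by apply: is_derive_eq (is_deriveV wn (is_derive_id _ _)) _;
      rewrite /GRing.scale/= mulr1.
  have dP : is_derive w (1:R) (fun v => v^-1 ^+ k) (k%:R * w^-1 ^+ k.-1 * - w ^- 2).
    by exact: is_derX.
  have dE : is_derive w (1:R) (fun v => expR (- (eps * v^-1)))
      (expR (- (eps * w^-1)) * (- (eps * - w ^- 2))).
    by apply: is_derive1_comp; apply: is_deriveN; exact: is_derZ.
  apply: is_derive_eq (is_derM dP dE) _.
  case: k {dP dE} => [|k] /=; first by rewrite !exprS expr0; field.
  by rewrite !exprS; set p := w^-1 ^+ k; field.
- rewrite !flatE_le0 // !mulr0 addr0.
  (* The difference quotient of [flatE k] at 0 is [flatE k.+1] itself, which tends to 0. *)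
  apply/is_derive1_caratheodory; exists (flatE k.+1); split.
  + move=> z; rewrite subr0 [flatE k 0]flatE_le0 // subr0 /flatE.
    by case: ltP => [z0|]; rewrite ?mul0r // exprS; field; rewrite gt_eqF.
  + rewrite /prop_for /continuous_at [X in _ --> X]flatE_le0 //.
    exact: flatE_cvg0.
  + by rewrite flatE_le0.
Unshelve. all: by end_near. Qed.

(* w exp (eps - eps / w): it runs from 0 to 1 on [0, 1], is flat at 0, and its
   slope is at most exp eps because (1 + y) exp (- y) <= 1. *)
Definition flatT w := expR eps * (w * flatE 0 w).
Definition flatT' w := expR eps * (flatE 0 w + eps * flatE 1 w).

Lemma is_derive_flatT w : is_derive w (1 : R) flatT (flatT' w).
Proof.
apply: is_derive_eq (is_derZ (expR eps)
  (is_derM (is_derive_id w 1) (is_derive_flatE 0 w))) _.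
rewrite /flatT' /flatE.
case: ltP => w0; last by ring.
by rewrite !exprS; field; rewrite gt_eqF.
Qed.

Lemma smooth01_flatT a b : smooth01 (fun u => flatT (a + b * u)).
Proof.
have sE : smooth01 (fun u : R => flatE 0 (a + b * u)).
  pose G g := exists k, g = (fun u : R => flatE k (a + b * u)).
  apply: (@falg_smooth _ G); last by apply: falg_gen; exists 0%N.
  have Gk k : falg G (fun u : R => flatE k (a + b * u)).
    by apply: falg_gen; exists k.
  move=> _ [k ->].
  exists (fun u => (- k%:R * flatE k.+1 (a + b * u)
                    + eps * flatE k.+2 (a + b * u)) * b).
    apply: falg_mul; last exact: falg_cst.
    by apply: falg_add; apply: falg_mul => //; exact: falg_cst.
  apply: is_derive_D01 => t; apply: is_derive1_comp.
    exact: is_derive_flatE.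
  apply: is_derive_eq; rewrite /GRing.scale/=; ring.
apply: smooth01_mul; first exact: smooth01_cst.
apply: smooth01_mul => //; apply: smooth01_add; first exact: smooth01_cst.
by apply: smooth01_mul; [exact: smooth01_cst|exact: smooth01_id].
Qed.

Lemma flatT_le0 w : w <= 0 -> flatT w = 0.
Proof. by move=> w0; rewrite /flatT flatE_le0 // !mulr0. Qed.

Lemma flatT'_le0 w : w <= 0 -> flatT' w = 0.
Proof. by move=> w0; rewrite /flatT' !flatE_le0 // mulr0 addr0 mulr0. Qed.

Lemma flatT1 : flatT 1 = 1.
Proof.
rewrite /flatT /flatE ltr01 expr0 invr1 mulr1 !mul1r -expRD subrr.
exact: expR0.
Qed.

Lemma flatT_lt v w : 0 <= v -> v < w -> flatT v < flatT w.
Proof.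
move=> v0 vw; have w0 := le_lt_trans v0 vw.
rewrite /flatT ltr_pM2l ?expR_gt0 // /flatE w0 !expr0 !mul1r.
case: (ltP 0 v) => v1; last by rewrite mulr0 mulr_gt0 ?expR_gt0.
apply: ltr_pM => //; rewrite ?expR_ge0 // ltr_expR ltrN2.
by rewrite ltr_pM2l // ltf_pV2.
Qed.

Lemma flatT'_ge0 w : 0 <= flatT' w.
Proof.
rewrite /flatT' /flatE; case: ltP => w0; last by rewrite !mulr0 addr0 mulr0.
rewrite mulr_ge0 ?expR_ge0 // addr_ge0 // ?mulr_ge0 // ?expR_ge0 ?ltW //.
by rewrite invr_gt0.
Qed.

Lemma flatT'_le w : flatT' w <= expR eps.
Proof.
rewrite /flatT' -[leRHS]mulr1 ler_wpM2l ?expR_ge0 // /flatE.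
case: ltP => w0; last by rewrite mulr0 addr0.
rewrite expr0 expr1 mul1r mulrA -{1}[expR (- _)]mul1r -mulrDl.
by rewrite expRN ler_pdivrMr ?expR_gt0 // mul1r expR_ge1Dx.
Qed.

End Flat.

(** * The logarithmic mean *)

Section Logmean.
Variable R : realType.
Implicit Types (s t u v p a b : R).

Lemma within_FTC (F f : R -> R) a b : a < b ->
  {within `[a, b], continuous F} -> {within `[a, b], continuous f} ->
  (forall x, a < x < b -> is_derive x (1 : R) F (f x)) ->
  (\int[lebesgue_measure]_(x in `[a, b]) (f x)%:E = (F b - F a)%:E)%E.
Proof.
move=> ab cF cf dF.
have [_ Fa Fb] := (continuous_within_itvP F ab).1 cF.
rewrite EFinB; apply: continuous_FTC2 => //.
  by split=> // x; rewrite in_itv/= => /dF[].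
by move=> x; rewrite in_itv/= => xab; rewrite derive1E; have [_ ->] := dF x xab.
Qed.

Lemma powR_mix s t p : 0 < s -> 0 < t ->
  s `^ (1 - p) * t `^ p = expR ((1 - p) * ln s + p * ln t).
Proof. by move=> s0 t0; rewrite /powR !gt_eqF // -expRD. Qed.

Lemma is_derive_mix s t p : is_derive p (1 : R)
  (fun p => expR ((1 - p) * ln s + p * ln t))
  (expR ((1 - p) * ln s + p * ln t) * (ln t - ln s)).
Proof.
have h : is_derive p (1 : R) (fun p => (1 - p) * ln s + p * ln t) (ln t - ln s).
  apply: is_derive_eq (is_derD (is_derM (is_derB (is_derC 1 p)
    (is_derive_id p 1)) (is_derC _ p)) (is_derM (is_derive_id p 1) (is_derC _ p))) _.
  by rewrite /id; ring.
exact: (is_der_comp (is_derive_expR _) h).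
Qed.

Lemma continuous_mix s t :
  {within `[0, 1], continuous (fun p => expR ((1 - p) * ln s + p * ln t))}.
Proof.
apply: continuous_subspaceT => p.
apply: differentiable_continuous; apply/derivable1_diffP.
by have [] := is_derive_mix s t p.
Qed.

Lemma logmean_pos s t : 0 < s -> 0 < t -> logmean s t =
  \int[@lebesgue_measure R]_(p in `[0, 1]) expR ((1 - p) * ln s + p * ln t).
Proof.
by move=> s0 t0; apply: eq_Rintegral => p _; rewrite powR_mix.
Qed.

Lemma logmeanss s : 0 < s -> logmean s s = s.
Proof.
move=> s0; rewrite logmean_pos // (@eq_Rintegral _ _ _ _ _ (fun=> s)).
  rewrite Rintegral_cst //= lebesgue_measure_itv /= lte_fin ltr01.
  by rewrite oppr0 adde0 /= mulr1.
by move=> p _; rewrite -mulrDl subrK mul1r lnK // posrE.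
Qed.

Lemma logmean_neq s t : 0 < s -> 0 < t -> s != t ->
  logmean s t = (s - t) / (ln s - ln t).
Proof.
move=> s0 t0 st; rewrite logmean_pos //.
have lst : ln t - ln s != 0.
  by rewrite subr_eq0; apply: contra_neq st => /ln_inj; rewrite !posrE => ->.
have dF p : is_derive p (1 : R)
    (fun p => (ln t - ln s)^-1 * expR ((1 - p) * ln s + p * ln t))
    (expR ((1 - p) * ln s + p * ln t)).
  apply: is_derive_eq (is_derZ _ (is_derive_mix s t p)) _.
  by rewrite mulrC mulfK.
rewrite /Rintegral (@within_FTC _ _ _ _ ltr01 _ (@continuous_mix s t)
  (fun p _ => dF p)) /=.
  rewrite subrr subr0 !mul0r !mul1r add0r addr0 !lnK ?posrE //.
  by rewrite -mulrBr -[t - s]opprB -[ln t - _]opprB invrN mulrNN mulrC.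
apply: continuous_subspaceT => p; apply: differentiable_continuous.
by apply/derivable1_diffP; have [] := dF p.
Qed.

Lemma logmean0l t : logmean 0 t = 0.
Proof.
rewrite /logmean /Rintegral -integral_itv_bndo_bndc.
  rewrite (eq_integral (fun=> 0%E)) ?integral0 // => p.
  rewrite inE /= in_itv/= => /andP[p0 p1]; congr EFin.
  by rewrite /powR eqxx subr_eq0 gt_eqF // mul0r.
apply/measurable_EFinP/measurable_funTS/measurable_funM => //.
  apply: (measurableT_comp (measurable_powRr _)).
  by apply: measurable_funB.
exact: measurable_powRr.
Qed.

Lemma logmean0r s : logmean s 0 = 0.
Proof.
rewrite /logmean /Rintegral -integral_itv_obnd_cbnd.
  rewrite (eq_integral (fun=> 0%E)) ?integral0 // => p.
  rewrite inE /= in_itv/= => /andP[p0 p1]; congr EFin.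
  by rewrite powR0 ?gt_eqF // mulr0.
apply/measurable_EFinP/measurable_funTS/measurable_funM => //.
  apply: (measurableT_comp (measurable_powRr _)).
  by apply: measurable_funB.
exact: measurable_powRr.
Qed.

Lemma logmean_ge0 s t : 0 <= logmean s t.
Proof. by apply: Rintegral_ge0 => p _; rewrite mulr_ge0 // powR_ge0. Qed.

(** Symmetry, homogeneity and measurability are read off this closed form, whereas monotonicity and
    concavity come from the integral. *)
Lemma logmeanE s t : 0 <= s -> 0 <= t -> logmean s t =
  if s == t then s else if (0 < s) && (0 < t)
    then (s - t) / (ln s - ln t) else 0.
Proof.
rewrite !le_eqVlt => /predU1P[<-|s0] /predU1P[<-|t0].
- by rewrite logmean0l eqxx.
- by rewrite logmean0l lt_eqF // ltxx.
- by rewrite logmean0r gt_eqF // ltxx andbF.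
- by have [<-|st] := eqVneq s t; rewrite ?logmeanss // logmean_neq // s0 t0.
Qed.

Lemma logmeanC s t : 0 <= s -> 0 <= t -> logmean s t = logmean t s.
Proof.
move=> s0 t0; rewrite !logmeanE // eq_sym andbC.
case: (eqVneq s t) => // _; case: ifP => // _.
by rewrite -[s - t]opprB -[ln s - _]opprB invrN mulrNN.
Qed.

(** The reason for the logarithmic mean: weighted by it, the discrete gradient of ln rho is that of
    rho, so the heat flow is the gradient flow of the entropy. *)
Lemma logmean_ln s t : 0 < s -> 0 < t -> logmean s t * (ln s - ln t) = s - t.
Proof.
move=> s0 t0; have [<-|st] := eqVneq s t; first by rewrite !subrr mulr0.
rewrite logmean_neq // mulfVK // subr_eq0.
by apply: contra_neq st => /ln_inj; rewrite !posrE => ->.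
Qed.

Lemma logmeanZ c s t : 0 <= c -> 0 <= s -> 0 <= t ->
  logmean (c * s) (c * t) = c * logmean s t.
Proof.
rewrite le_eqVlt => /predU1P[<-|c0] s0 t0; first by rewrite !mul0r logmean0l.
have c0' := ltW c0; rewrite !logmeanE ?mulr_ge0 // !pmulr_rgt0 //.
have cn : c != 0 by rewrite gt_eqF.
rewrite (inj_eq (mulfI cn)); case: (eqVneq s t) => // st.
case: ifP => [/andP[sp tp]|_]; last by rewrite mulr0.
by rewrite !lnM ?posrE // [ln c + ln s]addrC addrKA -mulrBr mulrA.
Qed.

Lemma mix_integrable s t : (@lebesgue_measure R).-integrable `[0, 1]
  (EFin \o (fun p => expR ((1 - p) * ln s + p * ln t))).
Proof.
apply: continuous_compact_integrable; first exact: segment_compact.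
exact: continuous_mix.
Qed.

Lemma logmean_le s t u v : 0 <= s <= u -> 0 <= t <= v ->
  logmean s t <= logmean u v.
Proof.
move=> /andP[]; rewrite le_eqVlt => /predU1P[<- _ _|s0 su].
  by rewrite logmean0l logmean_ge0.
move=> /andP[]; rewrite le_eqVlt => /predU1P[<- _|t0 tv].
  by rewrite logmean0r logmean_ge0.
have u0 := lt_le_trans s0 su; have v0 := lt_le_trans t0 tv.
rewrite !logmean_pos // le_Rintegral //; try exact: mix_integrable.
move=> p /=; rewrite in_itv/= => /andP[p0 p1].
rewrite ler_expR lerD // ler_wpM2l ?subr_ge0 // ler_ln ?posrE //.
Qed.

(* Weighted AM-GM, from the tangent line of exp at the mean. *)
Lemma expR_mean p u v : 0 <= p <= 1 ->
  expR ((1 - p) * u + p * v) <= (1 - p) * expR u + p * expR v.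
Proof.
move=> /andP[p0 p1]; set m := _ + _.
have E x : expR x = expR m * expR (x - m) by rewrite -expRD subrKC.
rewrite (E u) (E v) -[leLHS]mulr1 mulrCA [X in _ + X]mulrCA -mulrDr.
rewrite ler_wpM2l ?expR_ge0 //.
have hu := ler_wpM2l (_ : 0 <= 1 - p) (expR_ge1Dx (u - m)).
have hv := ler_wpM2l p0 (expR_ge1Dx (v - m)).
rewrite subr_ge0 in hu; have {}hu := hu p1.
apply: le_trans (lerD hu hv).
by rewrite [leRHS](_ : _ = 1) // /m; ring.
Qed.

(** After division by the right-hand side [M], AM-GM bounds the two terms by weighted means of s /
    (s + u), t / (t + v) and of u / (s + u), v / (t + v), which add up to 1. *)
Lemma mix_superadd s t u v p : 0 < s -> 0 < t -> 0 < u -> 0 < v -> 0 <= p <= 1 ->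
  expR ((1 - p) * ln s + p * ln t) + expR ((1 - p) * ln u + p * ln v) <=
  expR ((1 - p) * ln (s + u) + p * ln (t + v)).
Proof.
move=> s0 t0 u0 v0 p01; set M := expR (_ * ln (_ + _) + _).
have su0 : 0 < s + u by rewrite addr_gt0.
have tv0 : 0 < t + v by rewrite addr_gt0.
have key x y : 0 < x -> 0 < y -> expR ((1 - p) * ln x + p * ln y) <=
    M * ((1 - p) * (x / (s + u)) + p * (y / (t + v))).
  move=> x0 y0.
  have -> : (1 - p) * ln x + p * ln y =
     ((1 - p) * ln (s + u) + p * ln (t + v)) +
     ((1 - p) * ln (x / (s + u)) + p * ln (y / (t + v))).
    by rewrite !ln_div ?posrE //; ring.
  rewrite expRD ler_wpM2l ?expR_ge0 //.
  apply: le_trans (expR_mean _ _ p01) _.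
  by rewrite !lnK // posrE divr_gt0.
apply: le_trans (lerD (key _ _ s0 t0) (key _ _ u0 v0)) _.
by rewrite [leLHS](_ : _ = M) //; field; rewrite !gt_eqF.
Qed.

(** For a function homogeneous of degree one, superadditivity is concavity. If an argument vanishes,
    monotonicity is enough. *)
Lemma logmean_superadd s t u v : 0 <= s -> 0 <= t -> 0 <= u -> 0 <= v ->
  logmean s t + logmean u v <= logmean (s + u) (t + v).
Proof.
move=> s0 t0 u0 v0.
have h (x y z w : R) : 0 <= x -> 0 <= y -> 0 <= z -> 0 <= w ->
    logmean z w <= logmean (x + z) (y + w).
  by move=> *; apply: logmean_le; rewrite lerDr; apply/andP.
have h' (x y z w : R) : 0 <= x -> 0 <= y -> 0 <= z -> 0 <= w ->
    logmean x y <= logmean (x + z) (y + w).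
  by move=> *; apply: logmean_le; rewrite lerDl; apply/andP.
move: (s0); rewrite le_eqVlt => /predU1P[<-|s1].
  by rewrite logmean0l [leLHS]add0r h.
move: (t0); rewrite le_eqVlt => /predU1P[<-|t1].
  by rewrite logmean0r [leLHS]add0r h.
move: (u0); rewrite le_eqVlt => /predU1P[<-|u1].
  by rewrite (logmean0l v) [leLHS]addr0 h'.
move: (v0); rewrite le_eqVlt => /predU1P[<-|v1].
  by rewrite (logmean0r u) [leLHS]addr0 h'.
rewrite !logmean_pos ?addr_gt0 // -RintegralD //; try exact: mix_integrable.
apply: le_Rintegral => //; last 1 first.
- by move=> p /=; rewrite in_itv/= => p01; exact: mix_superadd.
- have := integrableD _ (mix_integrable s t) (mix_integrable u v).
  by apply.
- exact: mix_integrable.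
Qed.

Lemma logmean_ge_min c s t : 0 < c -> c <= s -> c <= t -> c <= logmean s t.
Proof.
by move=> c0 cs ct; rewrite -{1}(logmeanss c0) logmean_le // ltW.
Qed.

Lemma logmean_gt0 s t : 0 < s -> 0 < t -> 0 < logmean s t.
Proof.
move=> s0 t0; apply: (@lt_le_trans _ _ (Num.min s t)).
  by rewrite lt_min s0.
by apply: logmean_ge_min; rewrite ?lt_min ?s0 // ge_min lexx ?orbT.
Qed.

Lemma measurable_funV (D : set R) (f : R -> R) :
  measurable_fun D f -> measurable_fun D (fun x => (f x)^-1).
Proof.
(* The power with exponent -1 is the inverse only for nonnegative bases, so the square is inverted
   and the factor [f x] carries the sign. *)
move=> mf; rewrite (_ : (fun x => _) = fun x => f x * (f x ^+ 2) `^ (-1)).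
  apply: measurable_funM => //.
  apply: (measurableT_comp (@measurable_powR R (-1))).
  exact: measurable_funX.
apply/funext => x; rewrite powR_inv1 ?sqr_ge0 //.
have [->|fx0] := eqVneq (f x) 0; first by rewrite invr0 mul0r.
by field.
Qed.

Lemma measurable_logmean (D : set R) (f g : R -> R) : measurable D ->
  (forall x, D x -> 0 <= f x) -> (forall x, D x -> 0 <= g x) ->
  measurable_fun D f -> measurable_fun D g ->
  measurable_fun D (fun x => logmean (f x) (g x)).
Proof.
move=> mD f0 g0 mf mg.
apply: (eq_measurable_fun (fun x => if f x == g x then f x else
  if (0 < f x) && (0 < g x) then (f x - g x) / (ln (f x) - ln (g x)) else 0)).
  by move=> x /[!inE] Dx; rewrite logmeanE ?f0 ?g0.
apply: measurable_fun_if => //; first exact: measurable_fun_eqr.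
  exact: measurable_funS mf.
set D' := _ `&` _.
have mD' : measurable D'.
  by apply: (measurable_fun_eqr mf mg mD).
have sD : D' `<=` D by move=> x [].
have mf' := measurable_funS mD sD mf; have mg' := measurable_funS mD sD mg.
have mlf := measurableT_comp (@measurable_ln R) mf'.
have mlg := measurableT_comp (@measurable_ln R) mg'.
apply: measurable_fun_if => //.
  by apply: measurable_and; apply: measurable_fun_ltr.
apply: measurable_funS (_ : measurable_fun D' _) => //.
apply: measurable_funM; first exact: measurable_funB.
by apply: measurable_funV; exact: measurable_funB.
Qed.

End Logmean.

(** * Change of variables for measurable integrands *)

Section Density.
Local Open Scope ereal_scope.
Context d (T : measurableType d) (R : realType).
Variables (mu : {measure set T -> \bar R}) (h : T -> R).
Hypotheses (mh : measurable_fun setT h) (h0 : forall x, (0 <= h x)%R).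

(** The two proofs are arguments of the term so that the measure structure declared below can be
    inferred from it. *)
Definition density (_ : measurable_fun setT h) (_ : forall x, (0 <= h x)%R) :
  set T -> \bar R := fun A => \int[mu]_(x in A) (h x)%:E.

Let density0 : density mh h0 set0 = 0.
Proof. by rewrite /density integral_set0. Qed.

Let density_ge0 A : 0 <= density mh h0 A.
Proof. by apply: integral_ge0 => x _; rewrite lee_fin. Qed.

Let density_sigma_additive : semi_sigma_additive (density mh h0).
Proof.
move=> /= F mF tF mUF; rewrite /density; apply: cvg_toP.
  apply: ereal_nondecreasing_is_cvgn => m n mn.
  apply: lee_sum_nneg_natr => // k _ _; apply: integral_ge0 => /= x Fkx.
  by rewrite lee_fin.
rewrite ge0_integral_bigcup//=.
- by apply/measurable_funTS/measurableT_comp.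
- by move=> x _; rewrite lee_fin.
Qed.

HB.instance Definition _ := isMeasure.Build _ _ _
  (density mh h0) density0 density_ge0 density_sigma_additive.

Import HBNNSimple.

Let integral_density_nnsfun (f : {nnsfun T >-> R}) :
  \int[density mh h0]_x (f x)%:E = \int[mu]_x ((f x)%:E * (h x)%:E).
Proof.
under [LHS]eq_integral do rewrite fimfunE -fsumEFin//.
rewrite [LHS]ge0_integral_fsum//; last 2 first.
  - by move=> r; exact/measurable_EFinP/measurableT_comp.
  - by move=> n x _; rewrite EFinM nnfun_muleindic_ge0.
under [RHS]eq_integral.
  move=> x xD; rewrite muleC fimfunE -fsumEFin// ge0_mule_fsumr; last first.
    by move=> r; rewrite EFinM nnfun_muleindic_ge0.
  over.
rewrite [RHS]ge0_integral_fsum//; last 2 first.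
  - move=> r; apply/measurable_EFinP/measurable_funM => //.
    by apply/measurableT_comp.
  - move=> n x _; rewrite EFinM mule_ge0//; last by rewrite nnfun_muleindic_ge0.
    by rewrite lee_fin.
apply: eq_fsbigr => r _.
rewrite integralZl_indic_nnsfun//= integral_indic//= setIT.
under [RHS]eq_integral do rewrite -EFinM mulrCA EFinM.
have [r0|r0] := leP 0%R r.
  rewrite ge0_integralZl//; last 2 first.
  - by apply/measurable_EFinP/measurable_funM => //; exact: measurable_indic.
  - by move=> x _; rewrite lee_fin mulr_ge0.
  congr (_ * _); rewrite /density integral_mkcond.
  apply: eq_integral => x _; rewrite patchE indicE.
  by case: ifPn => _; rewrite ?mulr1 ?mulr0.
rewrite preimage_nnfun0 // /density integral_set0 mule0.
under eq_integral do rewrite indic0 mulr0 mule0.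
by rewrite integral0.
Qed.

Lemma ge0_integral_density (f : T -> \bar R) :
  measurable_fun setT f -> (forall x, 0 <= f x) ->
  \int[density mh h0]_x f x = \int[mu]_x (f x * (h x)%:E).
Proof.
move=> mf f0.
pose f_ := nnsfun_approx measurableT mf.
transitivity (lim (\int[density mh h0]_x (f_ n x)%:E @[n --> \oo])).
  rewrite -monotone_convergence//=.
  - apply: eq_integral => ? /[!inE] xD; apply/esym/cvg_lim => //=.
    exact: cvg_nnsfun_approx.
  - by move=> n; exact/measurable_EFinP/measurable_funTS.
  - by move=> n ? _; rewrite lee_fin.
  - by move=> ? _ ? ? mn; rewrite lee_fin; exact/lefP/nd_nnsfun_approx.
transitivity (lim (\int[mu]_x ((f_ n x)%:E * (h x)%:E) @[n --> \oo])).
  by apply: congr_lim; apply/funext => n /=; exact: integral_density_nnsfun.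
rewrite -monotone_convergence//=.
- apply: eq_integral => x _; apply/cvg_lim => //.
  apply: cvgeZr => //; exact: cvg_nnsfun_approx.
- by move=> n; apply/measurable_EFinP/measurable_funM.
- by move=> n x _; rewrite mule_ge0 ?lee_fin.
- move=> x _ m n mn; rewrite lee_wpmul2r ?lee_fin //.
  exact/lefP/nd_nnsfun_approx.
Qed.

End Density.

(** * Substitution by increasing maps and by reflections *)

Section Substitution.
Variable R : realType.
Local Notation mu := (@lebesgue_measure R).

Section Increasing.
Variables (a b : R) (F f : R -> R).
Hypothesis ab : a < b.
Hypothesis dF : forall x, is_derive x (1 : R) F (f x).
Hypothesis cf : continuous f.
Hypothesis f0 : forall x, a < x <= b -> 0 <= f x.
Hypothesis incrF : forall x y, a <= x -> x < y -> y <= b -> F x < F y.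

Let cF : continuous F.
Proof.
move=> x; apply: differentiable_continuous; apply/derivable1_diffP.
by have [] := dF x.
Qed.

Let mF : measurable_fun setT F.
Proof. exact: continuous_measurable_fun. Qed.

Let D : set R := `]a, b].
Let I : set R := `]F a, F b].
Let h := f \_ D.

Let mD : measurable D. Proof. exact: measurable_itv. Qed.
Let mI : measurable I. Proof. exact: measurable_itv. Qed.

Let mh : measurable_fun setT h.
Proof.
by apply/(measurable_restrictT _ _).1 => //;
  apply: measurable_funTS; exact: continuous_measurable_fun.
Qed.

Let h0 x : 0 <= h x.
Proof.
rewrite /h patchE; case: ifP => // xD; apply: f0.
by have := set_mem xD; rewrite /D /= in_itv.
Qed.

Let FD x : D x -> I (F x).
Proof.
rewrite /D /I /= !in_itv/= => /andP[ax xb]; rewrite incrF //=.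
by move: xb; rewrite le_eqVlt => /predU1P[->//|xb]; rewrite ltW // incrF // ltW.
Qed.

(** On intervals the substitution rule is the fundamental theorem of calculus; the intermediate
    value theorem supplies preimages of the ends. *)
Let itvE (c d : R) : (\int[mu]_(x in F @^-1` `]c, d]) (h x)%:E =
  mu (`]c, d] `&` I))%E.
Proof.
have -> : (\int[mu]_(x in F @^-1` `]c, d]) (h x)%:E =
    \int[mu]_(x in F @^-1` `]c, d] `&` D) (f x)%:E)%E.
  rewrite [RHS]integral_mkcondr; apply: eq_integral => x _.
  by rewrite /h !patchE; case: ifP.
have Iab : `]c, d] `&` I = `]Num.max c (F a), Num.min d (F b)]%classic.
  rewrite /I; apply/seteqP; split => x /=; rewrite !in_itv /= gt_max le_min.
    by move=> [/andP[-> ->] /andP[-> ->]].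
  by move=> /andP[/andP[-> ->] /andP[-> ->]].
rewrite Iab; set c' := Num.max _ _; set d' := Num.min _ _.
have Dab : F @^-1` `]c, d] `&` D = F @^-1` `]c', d'] `&` D.
  rewrite -Iab preimage_setI -setIA; congr (_ `&` _).
  by apply/seteqP; split => [x Dx|x []//]; split => //; exact: FD.
rewrite Dab lebesgue_measure_itv /= lte_fin.
have [cd|dc] := ltP c' d'; last first.
  rewrite (_ : _ `&` _ = set0) ?integral_set0 //.
  apply/seteqP; split => // x /= []; rewrite in_itv/= => /andP[c1 d1] _.
  by have := lt_le_trans c1 (le_trans d1 dc); rewrite ltxx.
have FaFb : F a <= F b by rewrite ltW // incrF.
have ex y : F a <= y <= F b -> exists2 x, a <= x <= b & F x = y.
  move=> /andP[ay yb]; have [||x xab <-] := @IVT _ F a b y (ltW ab).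
  - exact: continuous_subspaceT.
  - by rewrite min_l // max_r // ay.
  - by exists x => //; move: xab; rewrite in_itv.
have [xc xcab Fc] : exists2 x, a <= x <= b & F x = c'.
  apply: ex; rewrite le_max lexx orbT /= ltW // (lt_le_trans cd) //.
  by rewrite ge_min lexx orbT.
have [xd xdab Fd] : exists2 x, a <= x <= b & F x = d'.
  apply: ex; rewrite ge_min lexx orbT andbT ltW // (le_lt_trans _ cd) //.
  by rewrite le_max lexx orbT.
move: xcab xdab => /andP[axc xcb] /andP[axd xdb].
have mono x y : a <= x <= b -> a <= y <= b -> (F x < F y) = (x < y).
  move=> /andP[ax xb] /andP[ay yb]; have [xy|yx] := ltP x y.
    by rewrite incrF.
  apply/negbTE; rewrite -leNgt; move: yx; rewrite le_eqVlt => /predU1P[->//|yx].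
  by rewrite ltW // incrF.
have cdx : xc < xd by rewrite -mono ?axc ?axd // Fc Fd.
have -> : F @^-1` `]c', d'] `&` D = `]xc, xd]%classic.
  rewrite /D; apply/seteqP; split => x /=; rewrite !in_itv/=.
    rewrite -Fc -Fd => -[/andP[h1 h2] /andP[ax xb]].
    have xab : a <= x <= b by rewrite ltW.
    rewrite mono ?axc // in h1.
    by rewrite h1 /= leNgt -mono ?axd // -leNgt.
  move=> /andP[cx xd'].
  have ax := le_lt_trans axc cx; have xb := le_trans xd' xdb.
  by split; rewrite ?ax ?xb // -Fc -Fd mono ?axc ?(ltW ax) // cx /= leNgt mono ?axd ?(ltW ax) // -leNgt.
rewrite integral_itv_obnd_cbnd; last first.
  apply/measurable_EFinP. apply: measurable_funTS. exact: continuous_measurable_fun.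
by rewrite (within_FTC cdx (continuous_subspaceT cF) (continuous_subspaceT cf)
  (fun x _ => dF x)) Fc Fd EFinB.
Qed.

Let nu : {measure set (measurableTypeR R) -> \bar R} :=
  @measure_function_pushforward__canonical__measure_function_Measure
    _ _ (measurableTypeR R) (measurableTypeR R) R (density mu mh h0) F mF.

Let nuE E : nu E = (\int[mu]_(x in F @^-1` E) (h x)%:E)%E.
Proof. by []. Qed.

Let mu_nu E : measurable E -> mu (E `&` I) = nu E.
Proof.
move=> mE.
(* The pushforward [nu] lives on [I] only; adding the Lebesgue measure of the complement of [I]
   gives a measure that has the right value on all half-open intervals, so uniqueness of the
   Lebesgue measure applies. *)
pose m2 : {measure set (measurableTypeR R) -> \bar R} :=
  measure_add nu (mrestr mu (measurableC mI)).
have m2E A : m2 A = (nu A + mu (A `&` ~` I))%E by exact: measure_addE.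
have mum2 A : measurable A -> mu A = m2 A.
  apply: lebesgue_measure_unique => _ [[c d] _ <-] /=.
  rewrite m2E [X in (X + _)%E]nuE itvE.
  rewrite -measureU //=; first by rewrite -setIUr setUv setIT.
  - exact: measurableI.
  - by apply: measurableI => //; exact: measurableC.
  - by rewrite setIACA setICr setI0.
have := mum2 _ (measurableI _ _ mE mI).
rewrite m2E -setIA setICr setI0 measure0 adde0 => ->.
rewrite !nuE integral_mkcond [RHS]integral_mkcond.
apply: eq_integral => x _; rewrite !patchE /h !patchE.
have [xD|] := boolP (x \in D); last by rewrite !if_same.
rewrite preimage_setI in_setI (_ : (x \in F @^-1` I) = true) ?andbT //.
by apply: mem_set; apply: FD; exact: set_mem.
Qed.

(** Potentials are only measurable in time, and so are the energies to be substituted: hence the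
    identification of measures, and no continuity of [g]. *)
Lemma ge0_integral_subst (g : R -> \bar R) : measurable_fun setT g ->
  (forall x, 0 <= g x)%E ->
  (\int[mu]_(x in `]a, b]) (g (F x) * (f x)%:E) =
   \int[mu]_(y in `]F a, F b]) g y)%E.
Proof.
move=> mg g0.
transitivity (\int[nu]_(y in I) g y)%E; last first.
  by apply: eq_measure_integral => A mA AI; rewrite -mu_nu // setIidl.
rewrite ge0_integral_pushforward //; last first.
  exact: measurable_funTS.
transitivity (\int[density mu mh h0]_x (g (F x)))%E.
  rewrite ge0_integral_density //; last exact: measurableT_comp.
  rewrite [LHS]integral_mkcond; apply: eq_integral => x _.
  by rewrite patchE /h patchE; case: ifP => //; rewrite mule0.
rewrite [RHS]integral_mkcond.
rewrite !ge0_integral_density //.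
- apply: eq_integral => x _; rewrite patchE /h patchE.
  case: ifP => xD; last by rewrite !mule0.
  by rewrite mem_set //; apply: FD; exact: set_mem.
- apply/(measurable_restrictT _ _).1.
    by rewrite -[X in measurable X]setTI; apply: mF.
  by apply: measurable_funTS; exact: measurableT_comp.
- by move=> x; rewrite patchE; case: ifP => _ //; exact: g0.
- exact: (measurableT_comp mg mF).
Qed.

Lemma ge0_integral_subst01 (A : R -> R) : F a = 0 -> F b = 1 ->
  measurable_fun `[0 : R, 1] A -> (forall x, 0 <= A x) ->
  (\int[mu]_(x in `[a, b]) (f x * A (F x))%:E =
   \int[mu]_(y in `[0%R, 1%R]) (A y)%:E)%E.
Proof.
move=> Fa Fb mA A0; pose g : R -> \bar R := (EFin \o A) \_ `[0, 1].
have mg : measurable_fun setT g.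
  by apply/(measurable_restrictT _ _).1 => //; exact/measurable_EFinP.
have g0 x : (0 <= g x)%E by rewrite /g patchE; case: ifP => // _; rewrite lee_fin.
have gF x : D x -> (g (F x) * (f x)%:E = (f x * A (F x))%:E)%E.
  move=> Dx; rewrite /g patchE mem_set; first by rewrite muleC -EFinM.
  by have := FD Dx; rewrite /I Fa Fb /= !in_itv/= => /andP[/ltW -> ->].
have mfA : measurable_fun D (fun x => (f x * A (F x))%:E).
  apply: (eq_measurable_fun (fun x => (g (F x) * (f x)%:E)%E)).
    by move=> x /set_mem /gF.
  apply: measurable_funTS; apply: emeasurable_funM; first exact: measurableT_comp.
  by apply/measurable_EFinP; exact: continuous_measurable_fun.
rewrite -integral_itv_obnd_cbnd // -[RHS]integral_itv_obnd_cbnd; last first.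
  apply/measurable_EFinP; apply: measurable_funS mA => //.
  by move=> x; rewrite /= !in_itv/= => /andP[/ltW -> ->].
transitivity (\int[mu]_(x in `]a, b]) (g (F x) * (f x)%:E))%E.
  by apply: eq_integral => x /set_mem /gF ->.
rewrite ge0_integral_subst // Fa Fb; apply: eq_integral => x /set_mem x01.
rewrite /g patchE mem_set //; move: x01.
by rewrite /= !in_itv/= => /andP[/ltW -> ->].
Qed.

End Increasing.

Lemma ge0_integral_reflect (c a b : R) (g : R -> \bar R) :
  measurable_fun setT g -> (forall x, 0 <= g x)%E ->
  (\int[mu]_(x in `[a, b]) g (c - x)%R = \int[mu]_(x in `[(c - b)%R, (c - a)%R]) g x)%E.
Proof.
move=> mg g0; pose phi (x : R) : R := c - x.
have mphi : measurable_fun setT phi by apply: measurable_funB.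
pose nu : {measure set (measurableTypeR R) -> \bar R} :=
  @measure_function_pushforward__canonical__measure_function_Measure
    _ _ (measurableTypeR R) (measurableTypeR R) R mu phi mphi.
have munu A : measurable A -> mu A = nu A.
  apply: lebesgue_measure_unique => _ [[p q] _ <-] /=.
  rewrite /pushforward (_ : phi @^-1` _ = `[c - q, c - p[%classic); last first.
    apply/seteqP; split => x /=; rewrite !in_itv/= /phi => /andP[h1 h2];
    by apply/andP; split; lra.
  rewrite !lebesgue_measure_itv/= !lte_fin.
  have -> : (c - q < c - p) = (p < q) by rewrite ltrD2l ltrN2.
  by case: ifP => // _; congr EFin; ring.
transitivity (\int[nu]_(x in `[(c - b)%R, (c - a)%R]) g x)%E; last first.
  apply: eq_measure_integral => A mA _; exact/esym/munu.
rewrite ge0_integral_pushforward //; last exact: measurable_funTS.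
rewrite (_ : phi @^-1` _ = `[a, b]%classic) //.
apply/seteqP; split => x /=; rewrite !in_itv/= /phi => /andP[h1 h2];
by apply/andP; split; lra.
Qed.

End Substitution.

(** * The heat flow on the hypercube *)

Section Cube.
Variables (R : realType) (n : nat).
Local Notation X := (hypercube n).
Implicit Types (x y : X) (i j : 'I_n) (F G rho : X -> R) (l : seq 'I_n).

Lemma flipK i : involutive (fun x => flip x i).
Proof. by move=> x; apply/ffunP => j; rewrite !ffunE addbA addbb. Qed.

Lemma flipC x i j : flip (flip x i) j = flip (flip x j) i.
Proof. by apply/ffunP => k; rewrite !ffunE !addbA [(j == k) (+) _]addbC. Qed.

Lemma sum_flip (F : X -> R) i : \sum_x F (flip x i) = \sum_x F x.
Proof. by rewrite [RHS](reindex_inj (inv_inj (@flipK i))). Qed.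

Lemma kernel_neq0 x y : hypercube_kernel R x y != 0 -> exists i, y = flip x i.
Proof.
rewrite /hypercube_kernel; case: ifP => [|_]; last by rewrite eqxx.
move=> /fintype.card1P[i yx] _; exists i; apply/ffunP => j.
have := yx j; rewrite !inE ffunE eq_sym [j == i]eq_sym => <-.
by case: (x j); case: (y j).
Qed.

Lemma kernel_sum (F : X -> R) x :
  \sum_y F y * hypercube_kernel R x y = n%:R^-1 * \sum_i F (flip x i).
Proof.
rewrite (bigID (mem (codom (flip x)))) /= [X in _ + X]big1 => [|y].
  rewrite addr0 (eq_bigl (mem (codom (flip x)))) // -big_uniq /=; last first.
    by rewrite map_inj_uniq ?enum_uniq //; exact: flip_inj.
  rewrite big_map big_enum /= mulr_sumr; apply: eq_bigr => i _.
  by rewrite kernel_flip mulrC.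
apply: contraNeq; rewrite mulf_eq0 negb_or => /andP[_ /kernel_neq0[i ->]].
exact: codom_f.
Qed.

Lemma flip_invariant (F : X -> R) : (forall x i, F (flip x i) = F x) ->
  forall x y, F x = F y.
Proof.
move=> FT x y; have /connectP[p + ->] := hypercube_kernel_irreducible R x y.
elim: p x => //= z p IH x /andP[Kxz zp]; rewrite -IH //.
by have [i ->] : exists i, z = flip x i by apply: kernel_neq0; rewrite gt_eqF.
Qed.

(** By symmetry of the kernel, stationarity makes [pi] harmonic: it equals its mean over the
    neighbours. Expanding the Dirichlet energy with this identity gives 0, so [pi] is invariant
    under flips and hence constant. *)
Lemma stationary_hypercube (pi : X -> R) : (0 < n)%N ->
  is_stationary (@hypercube_kernel R n) pi -> pi = hypercube_unif R (n := n).
Proof.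
move=> n0 [pi0 pi1 piK].
have n0' : n%:R != 0 :> R by rewrite pnatr_eq0 -lt0n.
have avg y : \sum_i pi (flip y i) = n%:R * pi y.
  rewrite -(piK y) (eq_bigr (fun x => pi x * hypercube_kernel R y x)).
    by rewrite kernel_sum mulVKf.
  by move=> x _; rewrite hypercube_kernelC.
have piT x i : pi (flip x i) = pi x.
  have : \sum_y \sum_i (pi (flip y i) - pi y) ^+ 2 = 0.
    transitivity (\sum_y \sum_i (pi (flip y i)) ^+ 2 +
        \sum_y ((n%:R * pi y ^+ 2) - 2 * pi y * \sum_i pi (flip y i))).
      rewrite -big_split /=; apply: eq_bigr => y _.
      rewrite (eq_bigr (fun j => pi (flip y j) ^+ 2 +
        (pi y ^+ 2 + - (2 * pi y) * pi (flip y j)))) => [|j _]; last by ring.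
      rewrite !big_split /= sumr_const card_ord -mulr_sumr.
      by rewrite -[pi y ^+ 2 *+ n]mulr_natl mulNr.
    rewrite exchange_big /=.
    rewrite (eq_bigr (fun=> \sum_y pi y ^+ 2)) => [|j _]; last first.
      exact: (sum_flip (fun y => pi y ^+ 2)).
    rewrite sumr_const card_ord -[_ *+ n]mulr_natl mulr_sumr -big_split /= big1 // => y _.
    by rewrite avg; ring.
  move=> /eqP; rewrite psumr_eq0 => [/allP|y _]; last first.
    by rewrite sumr_ge0 // => j _; rewrite sqr_ge0.
  move=> /(_ x); rewrite mem_index_enum => /(_ isT) /=.
  rewrite psumr_eq0 => [/allP /(_ i)|j _]; last by rewrite sqr_ge0.
  by rewrite mem_index_enum => /(_ isT) /=; rewrite sqrf_eq0 subr_eq0 => /eqP.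
apply/funext => x; rewrite /hypercube_unif.
have N0 : #|hypercube n|%:R != 0 :> R.
  by rewrite pnatr_eq0 -lt0n; apply/card_gt0P; exists x.
apply: (mulfI N0); rewrite mulfV // -[RHS]pi1 mulr_natl.
rewrite (eq_bigr (fun=> pi x)) => [|y _]; last exact: flip_invariant.
by rewrite sumr_const.
Qed.

(* [flow1 e i] is the heat semigroup of the walk on the i-th coordinate alone;
   the heat semigroup at time r of the hypercube walk, with rate 1/n in each
   direction, is [flow e] for e = exp (-2r/n). *)
Definition flow1 (e : R) i F : X -> R :=
  fun x => (1 + e) / 2 * F x + (1 - e) / 2 * F (flip x i).

Definition flows (e : R) l F : X -> R := foldr (flow1 e) F l.

Definition flow (e : R) F : X -> R := flows e (enum 'I_n) F.

Lemma flows_flip e l F i x :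
  flows e l (fun y => F (flip y i)) x = flows e l F (flip x i).
Proof. by elim: l x => //= j l IH x; rewrite /flow1 !IH flipC. Qed.

Lemma flowsZ e l c F x : flows e l (fun y => c * F y) x = c * flows e l F x.
Proof. by elim: l x => //= j l IH x; rewrite /flow1 !IH; ring. Qed.

Lemma flowsN e l F x : flows e l (fun y => - F y) x = - flows e l F x.
Proof. by elim: l x => //= j l IH x; rewrite /flow1 !IH; ring. Qed.

Lemma flows_sum e l (I : finType) (F : I -> X -> R) x :
  flows e l (fun y => \sum_k F k y) x = \sum_k flows e l (F k) x.
Proof.
elim: l x => //= j l IH x; rewrite /flow1 !IH !mulr_sumr -big_split.
by apply: eq_bigr.
Qed.

Lemma flows1 l F x : flows 1 l F x = F x.
Proof.
by elim: l x => //= j l IH x; rewrite /flow1 !IH; field.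
Qed.

Lemma sum_flows e l F : \sum_x flows e l F x = \sum_x F x.
Proof.
elim: l => //= j l <-; rewrite /flow1 big_split /= -!mulr_sumr sum_flip.
by rewrite -mulrDl; field.
Qed.

Lemma flows_ge0 e l F : 0 <= e <= 1 -> (forall x, 0 <= F x) ->
  forall x, 0 <= flows e l F x.
Proof.
move=> /andP[e0 e1] F0; elim: l => //= j l IH x.
by rewrite addr_ge0 // mulr_ge0 ?IH // divr_ge0 // ?subr_ge0 // addr_ge0.
Qed.

(** Mass travels from [x0] to [x] by flipping coordinates of [l]: for each of them the staying or
    the flipping term is chosen according to whether [x] agrees with [x0] there, and both weights
    are positive. *)
Lemma flows_gt0 e l F x0 : 0 <= e < 1 -> (forall x, 0 <= F x) -> 0 < F x0 ->
  forall x, (forall j, j \notin l -> x j = x0 j) -> 0 < flows e l F x.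
Proof.
move=> /andP[e0 e1] F0 Fx0.
have e01 : 0 <= e <= 1 by rewrite e0 ltW.
elim: l => /= [x xx0|i l IH x xx0].
  by have -> : x = x0 by apply/ffunP => j; exact: xx0.
have a0 : 0 < (1 + e) / 2 by rewrite divr_gt0 // ltr_pwDl.
have b0 : 0 < (1 - e) / 2 by rewrite divr_gt0 // subr_gt0.
have [xi|xi] := eqVneq (x i) (x0 i).
  apply: ltr_pwDl; last by rewrite mulr_ge0 ?flows_ge0 // ltW.
  rewrite mulr_gt0 // IH // => j jl; have [->//|ji] := eqVneq j i.
  by apply: xx0; rewrite inE negb_or ji.
apply: ltr_wpDl; first by rewrite mulr_ge0 ?flows_ge0 // ltW.
rewrite mulr_gt0 // IH // => j jl; rewrite ffunE eq_sym.
have [->|ji] := eqVneq j i; first by move: xi; case: (x i); case: (x0 i).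
by apply: xx0; rewrite inE negb_or ji.
Qed.

Lemma flow_gt0 e F : 0 <= e < 1 -> (forall x, 0 <= F x) -> 0 < \sum_x F x ->
  forall x, 0 < flow e F x.
Proof.
move=> e01 F0; rewrite lt_neqAle eq_sym psumr_neq0 // => /andP[/hasP[x0 _ /= Fx0] _] x.
by apply: (flows_gt0 e01 F0 Fx0) => j; rewrite mem_enum.
Qed.

(** The heat equation with a moving datum. The equation e' = - c e makes each factor a semigroup of
    rate c / 2, and the generators add up because flips commute. *)
Lemma is_derive_flows (e : R -> R) c l (F : R -> X -> R) F' t :
  is_derive t (1 : R) e (- c * e t) ->
  (forall x, is_derive t (1 : R) (F ^~ x) (F' x)) ->
  forall x, is_derive t (1 : R) (fun u => flows (e u) l (F u) x)
    (flows (e t) l F' x + c / 2 *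
     \sum_(i <- l) (flows (e t) l (F t) (flip x i) - flows (e t) l (F t) x)).
Proof.
move=> de dF; elim: l => [|j l IH] x.
  by rewrite big_nil mulr0 addr0; exact: dF.
have dh : is_derive t (1 : R) (fun u => (1 + e u) / 2) (- c * e t / 2).
  apply: is_derive_eq (is_derM (is_derD (is_derC 1 t) de) (is_derC _ t)) _.
  by rewrite add0r mulr0 addr0.
have dk : is_derive t (1 : R) (fun u => (1 - e u) / 2) (c * e t / 2).
  apply: is_derive_eq (is_derM (is_derB (is_derC 1 t) de) (is_derC _ t)) _.
  by ring.
apply: is_derive_eq (is_derD (is_derM dh (IH x)) (is_derM dk (IH (flip x j)))) _.
rewrite big_cons /= /flow1 flipK.
set G := flows (e t) l (F t); set a := (1 + e t) / 2; set b := (1 - e t) / 2.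
set G' := flows (e t) l F'.
have -> : \sum_(i <- l) ((a * G (flip x i) + b * G (flip (flip x i) j)) -
    (a * G x + b * G (flip x j))) =
  a * (\sum_(i <- l) (G (flip x i) - G x)) +
  b * (\sum_(i <- l) (G (flip (flip x j) i) - G (flip x j))).
  rewrite !mulr_sumr -big_split /=; apply: eq_bigr => i _.
  by rewrite [flip (flip x i) j]flipC; ring.
by rewrite /a /b; field.
Qed.

(** Joint convexity of the energy c^2 / t in (c, t), in a product form that allows t = 0. *)
Lemma cauchy_schwarz2 (a b c1 c2 t1 t2 e1 e2 : R) : 0 <= a -> 0 <= b ->
  0 <= t1 -> 0 <= t2 -> 0 <= e1 -> 0 <= e2 ->
  c1 ^+ 2 <= t1 * e1 -> c2 ^+ 2 <= t2 * e2 ->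
  (a * c1 + b * c2) ^+ 2 <= (a * t1 + b * t2) * (a * e1 + b * e2).
Proof.
move=> a0 b0 t10 t20 e10 e20 h1 h2.
have cc : 2 * (c1 * c2) <= t1 * e2 + t2 * e1.
  have [cc0|cc0] := leP (c1 * c2) 0.
    apply: (@le_trans _ _ 0); first by rewrite mulr_ge0_le0.
    by rewrite addr_ge0 // mulr_ge0.
  have p1 : 0 <= 2 * (c1 * c2) by rewrite mulr_ge0 // ltW.
  have p2 : 0 <= t1 * e2 + t2 * e1 by rewrite addr_ge0 // mulr_ge0.
  rewrite -ler_sqr ?nnegrE //.
  have h := ler_pM (sqr_ge0 c1) (sqr_ge0 c2) h1 h2.
  rewrite (_ : (2 * _) ^+ 2 = 4 * (c1 ^+ 2 * c2 ^+ 2)); last by ring.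
  rewrite (_ : (_ + _) ^+ 2 = (t1 * e2 - t2 * e1) ^+ 2 +
    4 * (t1 * e1 * (t2 * e2))); last by ring.
  by rewrite -[leLHS]add0r lerD ?sqr_ge0 // ler_wpM2l.
rewrite (_ : (_ + _) ^+ 2 = a ^+ 2 * c1 ^+ 2 + b ^+ 2 * c2 ^+ 2 +
  a * b * (2 * (c1 * c2))); last by ring.
rewrite (_ : (_ + _) * _ = a ^+ 2 * (t1 * e1) + b ^+ 2 * (t2 * e2) +
  a * b * (t1 * e2 + t2 * e1)); last by ring.
by rewrite !lerD // ler_wpM2l ?sqr_ge0 ?mulr_ge0.
Qed.

Lemma logmean_concave (a b s t u v : R) : 0 <= a -> 0 <= b ->
  0 <= s -> 0 <= t -> 0 <= u -> 0 <= v ->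
  a * logmean s t + b * logmean u v <=
  logmean (a * s + b * u) (a * t + b * v).
Proof.
by move=> *; rewrite -!logmeanZ // logmean_superadd // mulr_ge0.
Qed.

(* E is an energy density for the flux c in direction i; the product form avoids
   dividing by a logarithmic mean that may vanish. *)
Definition flux_bound rho (c : X -> R) i (E : X -> R) :=
  (forall x, 0 <= E x) /\
  (forall x, c x ^+ 2 <= logmean (rho x) (rho (flip x i)) * E x).

(* Along direction i the flux is odd, so [flow1 e i] multiplies it by e; in the
   other directions [flow1] averages, and concavity of the logarithmic mean
   keeps the energy under control. *)
Lemma flux_bound_flows e l rho c i E : 0 <= e <= 1 ->
  (forall x, 0 <= rho x) -> (forall x, c (flip x i) = - c x) ->
  flux_bound rho c i E -> exists E',
    flux_bound (flows e l rho) (flows e l c) i E' /\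
    \sum_x E' x = e ^+ (2 * count_mem i l) * \sum_x E x.
Proof.
move=> e01 rho0 cN cE; have /andP[e0 e1] := e01.
have a0 : 0 <= (1 + e) / 2 by rewrite divr_ge0 // addr_ge0.
have b0 : 0 <= (1 - e) / 2 by rewrite divr_ge0 // subr_ge0.
have ab : (1 + e) / 2 + (1 - e) / 2 = 1 by field.
elim: l => [|j l [E1 [[E10 c1E1] sE1]]].
  by exists E; rewrite expr0 mul1r.
have r0 x : 0 <= flows e l rho x by exact: flows_ge0.
have cfN x : flows e l c (flip x i) = - flows e l c x.
  rewrite -flows_flip -flowsN; congr (flows e l _ x).
  by apply/funext => y; exact: cN.
have [->{j}|ji] := eqVneq j i.
  exists (fun x => e ^+ 2 * E1 x); split; last first.
    rewrite -mulr_sumr sE1 mulrA -exprD /= eqxx; congr (e ^+ _ * _).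
    by rewrite mulnDr.
  split=> [x|x]; first by rewrite mulr_ge0 // sqr_ge0.
  rewrite /= /flow1 flipK cfN.
  rewrite [X in X ^+ 2](_ : _ = e * flows e l c x); last by field.
  rewrite exprMn [leRHS]mulrCA ler_wpM2l ?sqr_ge0 //.
  apply: le_trans (c1E1 x) _; rewrite ler_wpM2r //.
  (* Mixing a pair with its swap cannot decrease a mean that is symmetric and concave. *)
  apply: le_trans (logmean_concave a0 b0 (r0 x) (r0 (flip x i))
    (r0 (flip x i)) (r0 x)).
  by rewrite [logmean (flows _ _ _ (flip x i)) _]logmeanC // -mulrDl ab mul1r.
exists (flow1 e j E1); split; last first.
  rewrite /= (negbTE ji) add0n -sE1.
  by have := sum_flows e [:: j] E1.
split=> [x|x]; first by rewrite addr_ge0 // mulr_ge0.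
rewrite /= /flow1 [flip (flip x i) j]flipC.
apply: le_trans (cauchy_schwarz2 a0 b0 _ _ _ _ (c1E1 x) (c1E1 (flip x j))) _;
  rewrite ?logmean_ge0 //.
rewrite ler_wpM2r //; first by rewrite addr_ge0 // mulr_ge0.
exact: logmean_concave.
Qed.

Lemma flux_bound_flow e rho c i E : 0 <= e <= 1 ->
  (forall x, 0 <= rho x) -> (forall x, c (flip x i) = - c x) ->
  flux_bound rho c i E -> exists E',
    flux_bound (flow e rho) (flow e c) i E' /\
    \sum_x E' x = e ^+ 2 * \sum_x E x.
Proof.
move=> e01 rho0 cN cE.
have [E' [cE' sE']] := flux_bound_flows (enum 'I_n) e01 rho0 cN cE.
exists E'; split => //; rewrite sE'.
by rewrite count_uniq_mem ?enum_uniq // mem_enum.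
Qed.

End Cube.

(** * Potentials realizing a given divergence *)

Section Laplacian.
Variables (R : realType) (X : finType).
Local Notation N := #|{: X}|.

Lemma sum_enum_val (F : X -> R) : \sum_(i < N) F (enum_val i) = \sum_x F x.
Proof. by rewrite -big_enum_val; apply: eq_bigl => x; rewrite inE. Qed.

(* The all-ones matrix minus the weighted graph Laplacian: adding the ones
   makes the Laplacian invertible without changing the equation on right-hand
   sides of zero sum. *)
Definition laplM (w : X -> X -> R) : 'M[R]_N :=
  \matrix_(i, j) (1 - w (enum_val i) (enum_val j) +
    (i == j)%:R * \sum_x w (enum_val i) x).

Lemma laplME (w : X -> X -> R) (f : X -> R) (i : 'I_N) :
  \sum_j laplM w i j * f (enum_val j) =
  \sum_x f x - \sum_x w (enum_val i) x * (f x - f (enum_val i)).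
Proof.
under eq_bigr => j _ do rewrite mxE mulrDl.
rewrite big_split /= [X in _ + X](bigD1 i) //= [X in _ + (_ + X)]big1 => [|j].
  rewrite eqxx mul1r addr0 -(sum_enum_val f) -!sum_enum_val mulr_suml.
  by rewrite -!sumrB -big_split /=; apply: eq_bigr => j _; ring.
by rewrite eq_sym => /negbTE ->; rewrite !mul0r.
Qed.

(** Pairing a kernel vector f with its equation gives (sum of f)^2 plus the Dirichlet form of f
    equal to 0. So f is constant by connectedness, and its sum vanishes. *)
Lemma laplM_unit (w : X -> X -> R) : (forall x y, 0 <= w x y) ->
  (forall x y, w x y = w y x) ->
  (forall f : X -> R, (forall x y, 0 < w x y -> f x = f y) ->
    forall x y, f x = f y) -> laplM w \in unitmx.
Proof.
move=> w0 wC wconn; rewrite -row_free_unit; apply: inj_row_free => v vM.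
pose f x := v 0 (enum_rank x).
have fE (i : 'I_N) : f (enum_val i) = v 0 i by rewrite /f enum_valK.
have Mf (i : 'I_N) : \sum_x f x - \sum_x w (enum_val i) x * (f x - f (enum_val i)) = 0.
  rewrite -(laplME w f i); have /rowP/(_ i) := vM; rewrite !mxE => vi.
  rewrite -[RHS]vi; apply: eq_bigr => j _; rewrite fE mulrC !mxE.
  rewrite wC eq_sym; case: eqP => [->|_] //.
  by rewrite !mul0r.
have Mf' y : \sum_x f x - \sum_x w y x * (f x - f y) = 0.
  by have := Mf (enum_rank y); rewrite enum_rankK.
have E : (\sum_x f x) ^+ 2 + 2^-1 * \sum_y \sum_x w y x * (f x - f y) ^+ 2 = 0.
  have h1 : \sum_y f y * (\sum_x f x - \sum_x w y x * (f x - f y)) = 0.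
    by rewrite big1 // => y _; rewrite Mf' mulr0.
  rewrite -[RHS]h1.
  under [RHS]eq_bigr => y _ do rewrite mulrBr.
  rewrite sumrB -mulr_suml -expr2; congr (_ + _).
  have h2 : \sum_y f y * (\sum_x w y x * (f x - f y)) =
      - \sum_y \sum_x w y x * (f x - f y) * f x.
    rewrite exchange_big /= -sumrN; apply: eq_bigr => y _.
    rewrite mulr_sumr -sumrN; apply: eq_bigr => x _.
    by rewrite (wC x y); ring.
  have h3 : \sum_y \sum_x w y x * (f x - f y) ^+ 2 =
     \sum_y \sum_x w y x * (f x - f y) * f x -
     \sum_y f y * (\sum_x w y x * (f x - f y)).
    rewrite -sumrB; apply: eq_bigr => y _.
    by rewrite mulr_sumr -sumrB; apply: eq_bigr => x _; ring.
  by rewrite h3 h2; field.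
have sq0 : 0 <= \sum_y \sum_x w y x * (f x - f y) ^+ 2.
  by do 2 (apply: sumr_ge0 => ? _); rewrite mulr_ge0 ?sqr_ge0.
have /andP[/eqP S0 /eqP D0] : (\sum_x f x == 0) &&
    (\sum_y \sum_x w y x * (f x - f y) ^+ 2 == 0).
  move/eqP: E; rewrite paddr_eq0 ?sqr_ge0 ?mulr_ge0 // sqrf_eq0.
  by rewrite mulf_eq0 invr_eq0 pnatr_eq0.
have fc x y : 0 < w x y -> f x = f y.
  move=> wxy; move: D0 => /eqP; rewrite psumr_eq0 => [/allP|? _]; last first.
    by apply: sumr_ge0 => ? _; rewrite mulr_ge0 ?sqr_ge0.
  move=> /(_ x (mem_index_enum _)) /=.
  rewrite psumr_eq0 => [/allP|? _]; last by rewrite mulr_ge0 ?sqr_ge0.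
  move=> /(_ y (mem_index_enum _)) /=.
  by rewrite mulf_eq0 gt_eqF //= sqrf_eq0 subr_eq0 => /eqP ->.
apply/rowP => i; rewrite mxE -fE.
have : N%:R * f (enum_val i) = 0.
  rewrite -[RHS]S0 (eq_bigr (fun=> f (enum_val i))) => [|x _]; last exact: wconn.
  by rewrite sumr_const mulr_natl.
move/eqP; rewrite mulf_eq0 pnatr_eq0 => /orP[/eqP N0|/eqP//].
by have := ltn_ord i; rewrite [X in (_ < X)%N -> _]N0.
Qed.

(* Cramer's rule, so that the solution is visibly measurable in the data. *)
Definition potential (w : X -> X -> R) (b : X -> R) x : R :=
  (\det (laplM w))^-1 *
    \sum_j \adj (laplM w) (enum_rank x) j * - b (enum_val j).

(** Cramer's rule solves the equation perturbed by the ones matrix. Summing that equation over all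
    points kills both the Laplacian and [b], so the solution has zero sum and the perturbation
    disappears. *)
Lemma potentialP (w : X -> X -> R) b : laplM w \in unitmx ->
  (forall x y, w x y = w y x) -> \sum_x b x = 0 ->
  forall x, \sum_y w x y * (potential w b y - potential w b x) = b x.
Proof.
move=> Mu wC b0; set psi := potential w b.
have M0 : \det (laplM w) != 0 by rewrite -unitfE.
have key x : \sum_y psi y - \sum_y w x y * (psi y - psi x) = - b x.
  rewrite -[x](enum_rankK x) -laplME; set k := enum_rank x.
  pose bv : 'cV[R]_N := \col_j - b (enum_val j).
  have : laplM w *m (\adj (laplM w) *m bv) = \det (laplM w) *: bv.
    by rewrite mulmxA mul_mx_adj mul_scalar_mx.
  move/colP/(_ k); rewrite !mxE => h.
  apply: (mulfI M0); rewrite -h mulr_sumr; apply: eq_bigr => j _.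
  rewrite mulrCA; congr (_ * _); rewrite /psi /potential enum_valK mulVKf //.
  by rewrite mxE; apply: eq_bigr => l _; rewrite !mxE.
have L0 : \sum_x \sum_y w x y * (psi y - psi x) = 0.
  set S := LHS; suff : S = - S by move=> SS; lra.
  rewrite {1}/S exchange_big /= /S -sumrN; apply: eq_bigr => x _.
  by rewrite -sumrN; apply: eq_bigr => y _; rewrite wC; ring.
move=> x; have : N%:R * \sum_y psi y = 0.
  transitivity (\sum_x (\sum_y psi y - \sum_y w x y * (psi y - psi x))).
    by rewrite sumrB L0 subr0 sumr_const mulr_natl.
  by rewrite (eq_bigr (fun x => - b x)) // sumrN b0 oppr0.
move/eqP; rewrite mulf_eq0 pnatr_eq0 => /orP[/eqP N0|/eqP S0].
  by have := fintype.card0_eq N0 x; rewrite !inE.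
by have := key x; rewrite S0 sub0r => /oppr_inj.
Qed.

Lemma measurable_det m (D : set R) (A : R -> 'M[R]_m) :
  (forall i j, measurable_fun D (fun u => A u i j)) ->
  measurable_fun D (fun u => \det (A u)).
Proof.
move=> mA; apply: measurable_sum => s; apply: measurable_funM => //.
exact: measurable_prod.
Qed.

Lemma measurable_potential (D : set R) (w : R -> X -> X -> R) (b : R -> X -> R) :
  (forall x y, measurable_fun D (fun u => w u x y)) ->
  (forall x, measurable_fun D (b ^~ x)) ->
  forall x, measurable_fun D (fun u => potential (w u) (b u) x).
Proof.
move=> mw mb x.
have mM i j : measurable_fun D (fun u => laplM (w u) i j).
  rewrite (_ : (fun u => _) = fun u => 1 - w u (enum_val i) (enum_val j) +
    (i == j)%:R * \sum_x w u (enum_val i) x).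
    apply: measurable_funD; first exact: measurable_funB.
    by apply: measurable_funM => //; exact: measurable_sum.
  by apply/funext => u; rewrite mxE.
apply: measurable_funM; first by apply: measurable_funV; exact: measurable_det.
apply: measurable_sum => j; apply: measurable_funM; last exact: measurableT_comp.
rewrite (_ : (fun u => _) = fun u => cofactor (laplM (w u)) j (enum_rank x)).
  apply: measurable_funM => //; apply: measurable_det => i k.
  rewrite (_ : (fun u => _) = fun u => laplM (w u) (lift j i) (lift (enum_rank x) k)) //.
  by apply/funext => u; rewrite !mxE.
by apply/funext => u; rewrite mxE.
Qed.

End Laplacian.

(** * Energy and divergence of fluxes on the hypercube *)

Section CubeEnergy.
Variables (R : realType) (n : nat).
Hypothesis n0 : (0 < n)%N.
Local Notation X := (hypercube n).
Local Notation K := (@hypercube_kernel R n).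
Implicit Types (x y : X) (i : 'I_n).

Let n0' : 0 < n%:R :> R. Proof. by rewrite ltr0n. Qed.
Let nn0 : n%:R != 0 :> R. Proof. by rewrite gt_eqF. Qed.

(** Summation by parts; every edge is seen from both of its ends, hence the factor 2. *)
Lemma antisym_sum (w : 'I_n -> X -> R) (f : X -> R) :
  (forall i x, w i (flip x i) = - w i x) ->
  \sum_x \sum_i w i x * (f (flip x i) - f x) = - 2 * \sum_x f x * \sum_i w i x.
Proof.
move=> wN; rewrite mulr_sumr exchange_big /=.
under [RHS]eq_bigr => x _ do rewrite mulr_sumr mulr_sumr.
rewrite [RHS]exchange_big /=; apply: eq_bigr => i _.
transitivity (\sum_x w i x * f (flip x i) - \sum_x w i x * f x).
  by rewrite -sumrB; apply: eq_bigr => x _; ring.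
rewrite -(sum_flip (fun x => w i x * f (flip x i)) i) -sumrB.
by apply: eq_bigr => x _; rewrite flipK wN; ring.
Qed.

Lemma antisym_sum0 (w : 'I_n -> X -> R) :
  (forall i x, w i (flip x i) = - w i x) -> \sum_x \sum_i w i x = 0.
Proof.
move=> wN; rewrite exchange_big /= big1 // => i _.
have : \sum_x w i x = - \sum_x w i x.
  by rewrite -{1}(sum_flip (w i) i) -sumrN; apply: eq_bigr => x _; rewrite wN.
by move=> h; lra.
Qed.

Lemma action_cube (p : R) (rho psi : X -> R) :
  action K (fun=> p) rho psi = p / 2 * n%:R^-1 * \sum_x \sum_i
    logmean (rho x) (rho (flip x i)) * (psi (flip x i) - psi x) ^+ 2.
Proof.
rewrite /action -!mulrA; transitivity (2^-1 * \sum_x (p * (n%:R^-1 *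
    \sum_i logmean (rho x) (rho (flip x i)) * (psi (flip x i) - psi x) ^+ 2))).
  congr (_ * _); apply: eq_bigr => x _; rewrite -mulr_suml mulrC.
  rewrite kernel_sum; congr (_ * (_ * _)); apply: eq_bigr => i _.
  by rewrite mulrC.
by rewrite -!mulr_sumr; ring.
Qed.

Lemma div_cube (rho psi : X -> R) x :
  \sum_y (psi y - psi x) * hat rho x y * K x y = n%:R^-1 * \sum_i
    logmean (rho x) (rho (flip x i)) * (psi (flip x i) - psi x).
Proof. by rewrite kernel_sum; congr (_ * _); apply: eq_bigr => i _; rewrite mulrC. Qed.

(** Young's inequality; with the weights n and 1 / n it is an equality for the gradient flux c = th
    d / n with E = th d^2 / n^2. *)
Lemma young_flux (c th E d : R) : 0 <= th -> 0 <= E -> c ^+ 2 <= th * E ->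
  2 * (c * d) <= n%:R * E + n%:R^-1 * (th * d ^+ 2).
Proof.
move=> th0 E0 cE; have p2 : 0 <= n%:R * E + n%:R^-1 * (th * d ^+ 2).
  apply: addr_ge0; first exact: mulr_ge0 (ler0n _ _) E0.
  apply: mulr_ge0; first by rewrite invr_ge0 ler0n.
  exact: mulr_ge0 th0 (sqr_ge0 d).
have [cd|cd] := leP (c * d) 0; first by apply: le_trans p2; rewrite mulr_ge0_le0.
rewrite -ler_sqr ?nnegrE //; last by rewrite mulr_ge0 // ltW.
rewrite (_ : (2 * _) ^+ 2 = 4 * d ^+ 2 * c ^+ 2); last by ring.
rewrite (_ : (_ + _) ^+ 2 = (n%:R * E - n%:R^-1 * (th * d ^+ 2)) ^+ 2 +
  4 * d ^+ 2 * (th * E)); last by field.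
by rewrite -[leLHS]add0r lerD ?sqr_ge0 // ler_wpM2l // mulr_ge0 // sqr_ge0.
Qed.

(* Among all fluxes with a given divergence, the gradient flux has the least
   energy. *)
Lemma action_le_flux (p : R) (rho psi : X -> R) (w E : 'I_n -> X -> R) :
  0 <= p -> (forall x, 0 <= rho x) ->
  (forall i x, w i (flip x i) = - w i x) ->
  (forall i, flux_bound rho (w i) i (E i)) ->
  (forall x, \sum_y (psi y - psi x) * hat rho x y * K x y = \sum_i w i x) ->
  action K (fun=> p) rho psi <= p / 2 * n%:R * \sum_i \sum_x E i x.
Proof.
move=> p0 rho0 wN wE psiw; rewrite action_cube -!mulrA.
apply: ler_wpM2l => //; apply: ler_wpM2l; first by rewrite invr_ge0.
set S := \sum_x _; pose d i x := psi (flip x i) - psi x.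
pose g i x := n%:R^-1 * (logmean (rho x) (rho (flip x i)) * d i x).
have gN i x : g i (flip x i) = - g i x.
  by rewrite /g /d flipK logmeanC // ; ring.
have Sg : n%:R^-1 * S = \sum_x \sum_i g i x * (psi (flip x i) - psi x).
  rewrite mulr_sumr; apply: eq_bigr => x _; rewrite mulr_sumr.
  by apply: eq_bigr => i _; rewrite /g /d; ring.
(* Paired with a gradient, a flux is seen only through its divergence, so [w] can replace the
   gradient flux [g]. *)
have Sw : n%:R^-1 * S = \sum_x \sum_i w i x * (psi (flip x i) - psi x).
  rewrite Sg !antisym_sum //; congr (_ * _); apply: eq_bigr => x _.
  by congr (_ * _); rewrite -psiw div_cube mulr_sumr.
have : 2 * (n%:R^-1 * S) <= \sum_x \sum_i (n%:R * E i x +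
    n%:R^-1 * (logmean (rho x) (rho (flip x i)) * d i x ^+ 2)).
  rewrite Sw mulr_sumr ler_sum // => x _; rewrite mulr_sumr ler_sum // => i _.
  by have [E0 cE] := wE i; apply: young_flux; rewrite ?logmean_ge0.
have -> : \sum_x \sum_i (n%:R * E i x +
    n%:R^-1 * (logmean (rho x) (rho (flip x i)) * d i x ^+ 2)) =
    n%:R * (\sum_i \sum_x E i x) + n%:R^-1 * S.
  rewrite [X in n%:R * X]exchange_big /= !mulr_sumr -big_split /=.
  by apply: eq_bigr => x _; rewrite !mulr_sumr -big_split.
by move=> h; lra.
Qed.

Lemma potential_cube (rho b : X -> R) : (forall x, 0 < rho x) ->
  \sum_x b x = 0 -> forall x,
  let psi := potential (fun x y => hat rho x y * K x y) b in
  \sum_y (psi y - psi x) * hat rho x y * K x y = b x.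
Proof.
move=> rho0 b0 x psi.
have wC y z : hat rho y z * K y z = hat rho z y * K z y.
  by rewrite /hat logmeanC ?ltW // hypercube_kernelC.
have w0 y z : 0 <= hat rho y z * K y z.
  by rewrite mulr_ge0 ?logmean_ge0 // (hypercube_kernel_markov R n0).1.
have Mu : laplM (fun x y => hat rho x y * K x y) \in unitmx.
  apply: laplM_unit => // f fw; apply: flip_invariant => y i.
  rewrite (fw y (flip y i)) // kernel_flip mulr_gt0 ?invr_gt0 //.
  exact: logmean_gt0.
rewrite -[RHS](potentialP Mu wC b0 x).
by apply: eq_bigr => y _; rewrite -mulrA mulrC.
Qed.

End CubeEnergy.

(** * Admissible curves obtained from fluxes *)

Section FluxCurve.
Variables (R : realType) (n : nat).
Hypothesis n0 : (0 < n)%N.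
Local Notation X := (hypercube n).
Local Notation K := (@hypercube_kernel R n).
Local Notation mu := (@lebesgue_measure R).
Implicit Types (x y : X) (i : 'I_n).

Lemma D01_measurable (f f' : R -> R) : D01 f f' -> measurable_fun `[0 : R, 1] f.
Proof. by move=> Df; apply: subspace_continuous_measurable_fun => //; exact: D01_within Df. Qed.

Lemma smooth01_measurable (f : R -> R) : smooth01 f -> measurable_fun `[0 : R, 1] f.
Proof. by move=> /smooth01_D01[f' [/D01_measurable]]. Qed.

Lemma measurable_hat (pi : X -> R) (g : R -> X -> R) x y :
  (forall z, smooth01 (g ^~ z)) ->
  (forall t, 0 <= t <= 1 -> is_density pi (g t)) ->
  measurable_fun `[0 : R, 1] (fun t => hat (g t) x y).
Proof.
move=> sg dg; apply: measurable_logmean => //.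
- by move=> t; rewrite /= in_itv => /dg[].
- by move=> t; rewrite /= in_itv => /dg[].
- exact: smooth01_measurable.
- exact: smooth01_measurable.
Qed.

Lemma measurable_action (pi rho0 rho1 : X -> R) (rho psi : R -> X -> R) :
  admissible K pi rho0 rho1 rho psi ->
  measurable_fun `[0 : R, 1] (fun t => action K pi (rho t) (psi t)).
Proof.
move=> [sm dens _ mpsi _]; apply: measurable_funM => //.
apply: measurable_sum => x; apply: measurable_sum => y.
do 2 (apply: measurable_funM => //).
apply: measurable_funM; last exact: measurable_hat sm dens.
by apply: measurable_funX; apply: measurable_funB; exact: mpsi.
Qed.

Lemma action_ge0 (p : R) (rho psi : X -> R) : 0 <= p ->
  0 <= action K (fun=> p) rho psi.
Proof.
move=> p0; rewrite /action mulr_ge0 //.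
do 2 (apply: sumr_ge0 => ? _); apply: mulr_ge0 => //.
apply: mulr_ge0; last exact: (hypercube_kernel_markov R n0).1.
by apply: mulr_ge0; [exact: sqr_ge0|exact: logmean_ge0].
Qed.

Lemma W2_le (pi rho0 rho1 : X -> R) (rho psi : R -> X -> R) :
  admissible K pi rho0 rho1 rho psi ->
  (W2 K pi rho0 rho1 <=
   \int[mu]_(t in `[0%R : R, 1%R]) (action K pi (rho t) (psi t))%:E)%E.
Proof. by move=> adm; apply: ereal_inf_lbound; exists rho, psi. Qed.

(** Competitors for W are thus given by odd fluxes, which need not be gradients. The potential is
    computed from the derivative of [g] and not from [w], because measurability in time is known for
    that derivative. *)
Lemma flux_curve (p : R) (rho0 rho1 : X -> R) (g : R -> X -> R)
    (w : R -> 'I_n -> X -> R) : 0 <= p ->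
  (forall x, smooth01 (g ^~ x)) ->
  (forall t, 0 <= t <= 1 -> is_density (fun=> p) (g t)) ->
  g 0 = rho0 -> g 1 = rho1 ->
  (forall (t : R) x, 0 < t < 1 -> 0 < g t x) ->
  (forall (t : R) i x, 0 < t < 1 -> w t i (flip x i) = - w t i x) ->
  (forall (t : R) x, 0 < t < 1 -> is_derive t (1 : R) (g ^~ x) (- \sum_i w t i x)) ->
  exists psi, admissible K (fun=> p) rho0 rho1 g psi /\
    forall (t : R) E, 0 < t < 1 -> (forall i, flux_bound (g t) (w t i) i (E i)) ->
      action K (fun=> p) (g t) (psi t) <= p / 2 * n%:R * \sum_i \sum_x E i x.
Proof.
move=> p0 sg dg g0 g1 gpos wN dgw.
have /choice[g' g'P] : forall x, exists g', D01 (g ^~ x) g' /\ exists g'', D01 g' g''.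
  by move=> x; exact: smooth01_D01.
pose psi t := potential (fun x y => hat (g t) x y * K x y) (fun x => - g' x t).
have g'w (t : R) x : 0 < t < 1 -> g' x t = - \sum_i w t i x.
  move=> t01; have [Dg _] := g'P x.
  by have [_ <-] := D01_is_derive Dg t01; have [_ <-] := dgw t x t01.
have psiP (t : R) x : 0 < t < 1 ->
    \sum_y (psi t y - psi t x) * hat (g t) x y * K x y = \sum_i w t i x.
  move=> t01; rewrite potential_cube //; first by rewrite g'w // opprK.
    by move=> y; exact: gpos.
  rewrite (eq_bigr (fun x => \sum_i w t i x)) => [|y _].
    by apply: antisym_sum0 => i y; exact: wN.
  by rewrite g'w // opprK.
exists psi; split; last first.
  move=> t E t01 wE; apply: (action_le_flux n0 p0 _ _ wE).
  - by move=> x; exact/ltW/gpos.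
  - by move=> i x; exact: wN.
  - by move=> x; exact: psiP.
split=> //.
- move=> x; apply: measurable_potential.
    by move=> y z; apply: measurable_funM => //; exact: measurable_hat sg dg.
  move=> y; apply: measurableT_comp => //.
  by have [_ [g'' /D01_measurable]] := g'P y.
- by move=> t x t01; rewrite derive1E; have [_ ->] := dgw t x t01; rewrite psiP // addNr.
Qed.

End FluxCurve.

(** * Finiteness of the distance *)

Section Xlnx.
Variable R : realType.

(** For 0 < x < 1 only the square root remains, by ln y < y at y = 1 / sqrt x; this gives the limit
    of x ln x at 0. *)
Lemma xlnx_bound (x : R) : `|x * ln x| <= `|x| * Num.max 0 (ln x) + 2 * Num.sqrt `|x|.
Proof.
have [x0|x0] := leP x 0.
  by rewrite ln0 // mulr0 normr0 maxxx mulr0 add0r mulr_ge0 // sqrtr_ge0.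
rewrite normrM (gtr0_norm x0).
have [l0|l0] := leP 0 (ln x).
  by rewrite ger0_norm // lerDl mulr_ge0 // sqrtr_ge0.
rewrite mulr0 add0r ltr0_norm //.
have s0 : 0 < Num.sqrt x by rewrite sqrtr_gt0.
have sx : x = Num.sqrt x ^+ 2 by rewrite sqr_sqrtr // ltW.
have := ln_sublinear (_ : 0 < (Num.sqrt x)^-1); rewrite invr_gt0 => /(_ s0).
rewrite lnV ?posrE // => h.
have -> : ln x = 2 * ln (Num.sqrt x).
  by rewrite {1}sx lnXn // mulr_natl.
rewrite {1}sx -mulrN.
rewrite [leRHS](_ : _ = Num.sqrt x ^+ 2 * (2 * (Num.sqrt x)^-1)); last first.
  by field; rewrite gt_eqF.
by rewrite ler_wpM2l ?sqr_ge0 // ler_wpM2l // ltW.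
Qed.

Lemma continuous_xlnx : continuous (fun x : R => x * ln x).
Proof.
move=> x; have [x0|x0|->] := ltgtP x 0.
- rewrite /continuous_at ln0 ?ltW // mulr0.
  apply: cvg_near_cst; near=> y; rewrite ln0 ?mulr0 // ltW //.
  by near: y; exact: lt_nbhsl.
- by apply: cvgM; [exact: cvg_id|exact: continuous_ln].
- rewrite /continuous_at mul0r; apply/norm_cvg0P.
  have h : 2 * Num.sqrt `|y| @[y --> (0 : R)] --> 0.
    rewrite -[X in _ --> X](mulr0 2); apply: cvgM; first exact: cvg_cst.
    rewrite -[X in _ --> X](sqrtr0 R).
    apply: (continuous_cvg _ (@sqrt_continuous R 0)).
    by rewrite -[X in _ --> X](@normr0 _ R); apply: cvg_norm; exact: cvg_id.
  apply: (squeeze_cvgr _ (cvg_cst 0) h).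
  near=> y => /=; rewrite normr_ge0 /= (le_trans (xlnx_bound y)) //.
  rewrite max_l ?mulr0 ?add0r // ln_le0 // ltW //.
  by near: y; apply: lt_nbhsl.
Unshelve. all: by end_near. Qed.

Lemma is_derive_xlnx (x : R) : 0 < x ->
  is_derive x (1 : R) (fun x => x * ln x) (ln x + 1).
Proof.
move=> x0; apply: is_derive_eq (is_derM (is_derive_id x 1) (is_derive1_ln x0)) _.
by rewrite mul1r /id mulfV // gt_eqF.
Qed.

End Xlnx.

Section Finite.
Variables (R : realType) (n : nat).
Hypothesis n0 : (0 < n)%N.
Local Notation X := (hypercube n).
Local Notation K := (@hypercube_kernel R n).
Local Notation mu := (@lebesgue_measure R).
Implicit Types (x y : X) (i : 'I_n).

Lemma smooth01_flows (e : R -> R) l (F : R -> X -> R) :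
  smooth01 e -> (forall x, smooth01 (F ^~ x)) ->
  forall x, smooth01 (fun u => flows (e u) l (F u) x).
Proof.
move=> se sF; elim: l => //= j l IH x; rewrite /flow1.
apply: smooth01_add; apply: smooth01_mul => //.
- apply: smooth01_mul; last exact: smooth01_cst.
  by apply: smooth01_add => //; exact: smooth01_cst.
- apply: smooth01_mul; last exact: smooth01_cst.
  by apply: smooth01_add; [exact: smooth01_cst|exact: smooth01_opp].
Qed.

(** The gradient flux at the constant density 1, where the Laplacian is invertible up to
    constants. *)
Lemma flux_exists (b : X -> R) : \sum_x b x = 0 -> exists w : 'I_n -> X -> R,
  (forall i x, w i (flip x i) = - w i x) /\ forall x, \sum_i w i x = b x.
Proof.
move=> b0; pose r (_ : X) : R := 1.
pose psi := potential (fun x y => hat r x y * K x y) b.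
exists (fun i x => n%:R^-1 * (logmean 1 1 * (psi (flip x i) - psi x))); split.
  by move=> i x; rewrite flipK; ring.
move=> x; have r0 y : 0 < r y by [].
by rewrite -[RHS](potential_cube n0 r0 b0 x) div_cube mulr_sumr.
Qed.

(** Finiteness turns the geodesic identity into one between reals. The segment between two densities
    may stay on the boundary, where logarithmic means vanish, so the curve is pushed inside by
    adding constant density. *)
Lemma W2_lty (p : R) (rho0 rho1 : X -> R) : is_density (fun=> p) (fun _ : X => 1) ->
  0 <= p ->
  is_density (fun=> p) rho0 -> is_density (fun=> p) rho1 ->
  (W2 K (fun=> p) rho0 rho1 < +oo)%E.
Proof.
move=> [_ p1] p0 [r0 s0] [r1 s1].
have pn0 : p != 0.
  apply/eqP => pE; move: p1; rewrite big1 => [/esym/eqP|x _]; last first.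
    by rewrite pE mul0r.
  by rewrite oner_eq0.
have sum0 (f h : X -> R) : \sum_x p * f x = 1 -> \sum_x p * h x = 1 ->
    \sum_x (f x - h x) = 0.
  rewrite -!mulr_sumr => sf sh; apply: (mulfI pn0).
  by rewrite mulr0 sumrB mulrBr sf sh subrr.
have [w1 [w1N w1E]] := flux_exists (sum0 _ _ s1 s0).
have [w2 [w2N w2E]] := flux_exists (sum0 _ _ p1 s0).
(* The weight (t (1 - t))^2 of the constant density bounds the logarithmic means
   from below by the square of the speed. *)
pose g (t : R) x : R := rho0 x + (3 * t ^+ 2 - 2 * t ^+ 3) * (rho1 x - rho0 x) +
  (t * (1 - t)) ^+ 2 * (1 - rho0 x).
(* Both time profiles in [g] were chosen with derivatives divisible by t (1 - t): they are 6 t (1 -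
   t) and 2 t (1 - t) (1 - 2 t). *)
pose w (t : R) i x : R := - (t * (1 - t)) * (6 * w1 i x + 2 * (1 - 2 * t) * w2 i x).
have gE t x : g t x = (1 - t) ^+ 2 * (1 + 2 * t - t ^+ 2) * rho0 x +
   t ^+ 2 * (3 - 2 * t) * rho1 x + (t * (1 - t)) ^+ 2.
  by rewrite /g; ring.
have glb (t : R) x : 0 <= t <= 1 -> (t * (1 - t)) ^+ 2 <= g t x.
  move=> /andP[t0 t1]; rewrite gE lerDr addr_ge0 // mulr_ge0 //.
    by rewrite mulr_ge0 ?sqr_ge0 //; nra.
  by rewrite mulr_ge0 ?sqr_ge0 //; lra.
have smid := @smooth01_id R; have scst := @smooth01_cst R.
have sg x : smooth01 (g ^~ x).
  rewrite /g; apply: smooth01_add; first apply: smooth01_add => //.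
    apply: smooth01_mul => //; apply: smooth01_add.
      by apply: smooth01_mul => //; apply: smooth01_mul.
    apply: smooth01_opp; apply: smooth01_mul => //.
    by apply: smooth01_mul => //; apply: smooth01_mul.
  apply: smooth01_mul => //.
  have sq : smooth01 (fun t : R => t * (1 - t)).
    apply: smooth01_mul => //; apply: smooth01_add => //; exact: smooth01_opp.
  by apply: (smooth01_mul sq sq).
have [||||||psi [adm act]] := @flux_curve R n n0 p rho0 rho1 g w p0 sg.
- move=> t t01; split=> [x|]; first by apply: le_trans (glb t x t01); rewrite sqr_ge0.
  transitivity (\sum_x (p * rho0 x + ((3 * t ^+ 2 - 2 * t ^+ 3) *
     (p * rho1 x - p * rho0 x) + (t * (1 - t)) ^+ 2 * (p * 1 - p * rho0 x)))).
    by apply: eq_bigr => x _; rewrite /g; ring.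
  rewrite !big_split /= s0 -[X in _ + (X + _)]mulr_sumr -[X in _ + (_ + X)]mulr_sumr.
  by rewrite !sumrB p1 s0 s1 !subrr !mulr0 !addr0.
- by apply/funext => x; rewrite /g; ring.
- by apply/funext => x; rewrite /g; ring.
- move=> t x /andP[t0 t1]; apply: lt_le_trans (glb t x _); last by rewrite !ltW.
  by rewrite exprn_gt0 // mulr_gt0 // subr_gt0.
- by move=> t i x _; rewrite /w w1N w2N; ring.
- move=> t x _.
  have -> : - \sum_i w t i x =
     t * (1 - t) * (6 * (rho1 x - rho0 x) + 2 * (1 - 2 * t) * (1 - rho0 x)).
    rewrite /w -mulr_sumr big_split /= -!mulr_sumr w1E w2E; ring.
  have d1 := is_derive_id t 1.
  apply: is_derive_eq (is_derD (is_derD (is_derC _ _) (is_derM (is_derB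
    (is_derZ 3 (is_derX 2 d1)) (is_derZ 2 (is_derX 3 d1))) (is_derC _ _)))
    (is_derM (is_derX 2 (is_derM d1 (is_derB (is_derC 1 t) d1))) (is_derC _ _))) _.
  by rewrite /id /=; ring.
pose C : R := p / 2 * n%:R * \sum_i \sum_x (6 * `|w1 i x| + 2 * `|w2 i x|) ^+ 2.
apply: le_lt_trans (W2_le adm) _.
have mA := measurable_action adm.
rewrite integral_itv_bndoo; last first.
  apply/measurable_EFinP; apply: measurable_funS mA => //.
  exact: subset_itv_oo_cc.
apply: (@le_lt_trans _ _ (\int[mu]_(t in `]0%R, 1%R[) C%:E)%E).
  apply: ge0_le_integral => //.
  - by move=> t _; rewrite lee_fin action_ge0.
  - apply/measurable_EFinP; apply: measurable_funS mA => //.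
    exact: subset_itv_oo_cc.
  - move=> t; rewrite /= in_itv/= => t01; rewrite lee_fin; apply: act => // i.
    split=> [x|x]; first exact: sqr_ge0.
    have /andP[t0 t1] := t01.
    have t01' : 0 <= t <= 1 by rewrite !ltW.
    rewrite /w exprMn sqrrN; apply: ler_pM; rewrite ?sqr_ge0 //.
      apply: logmean_ge_min; rewrite ?glb //.
      by rewrite exprn_gt0 // mulr_gt0 // subr_gt0.
    rewrite -[leLHS]real_normK ?num_real // lerXn2r ?nnegrE //.
    apply: le_trans (ler_normD _ _) _; rewrite !normrM !normr_nat lerD //.
    rewrite ler_wpM2r // -[leRHS]mulr1 ler_wpM2l // ler_norml.
    by apply/andP; split; lra.
rewrite integral_cst //= lebesgue_measure_itv /= lte_fin ltr01 oppr0 adde0 mule1.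
exact: ltry.
Qed.

End Finite.

(** * The evolution variational inequality *)

Section IntIneq.
Variable R : realType.
Local Notation mu := (@lebesgue_measure R).

(** Continuity of [h'] is asked only away from 0: in the application it contains the logarithm of a
    density that may vanish at time 0. The bound is integrated over ]e, 1[ and passes to the limit
    by monotone convergence. *)
Lemma integral_le_ftc (A B h h' : R -> R) :
  (forall t, 0 <= A t) -> (forall t : R, 0 <= t <= 1 -> 0 <= B t) ->
  measurable_fun `[0 : R, 1] A -> measurable_fun `[0 : R, 1] B ->
  {within `[0 : R, 1], continuous h} ->
  (forall e : R, 0 < e < 1 -> {within `[e, 1], continuous h'}) ->
  (forall t : R, 0 < t < 1 -> is_derive t (1 : R) h (h' t)) ->
  (forall t : R, 0 < t < 1 -> A t + h' t <= B t) ->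
  (\int[mu]_(t in `[0%R : R, 1%R]) (A t)%:E <=
   \int[mu]_(t in `[0%R : R, 1%R]) (B t)%:E + (h 0 - h 1)%:E)%E.
Proof.
move=> A0 B0 mA mB ch ch' dh AB.
have IB0 : (0 <= \int[mu]_(t in `[0%R : R, 1%R]) (B t)%:E)%E.
  by apply: integral_ge0 => t; rewrite /= in_itv/= lee_fin => /B0.
have [Boo|Bfin] := eqVneq (\int[mu]_(t in `[0%R : R, 1%R]) (B t)%:E)%E +oo%E.
  by rewrite Boo addye // leey.
have iB : mu.-integrable `[0%R : R, 1%R] (EFin \o B).
  apply/integrableP; split; first exact/measurable_EFinP.
  under eq_integral => t /set_mem.
    rewrite /= in_itv/= => t01; rewrite ger0_norm; last exact: B0.
    over.
  by rewrite ltey.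
have step (e : R) : 0 < e < 1 -> (\int[mu]_(t in `]e, 1%R[) (A t)%:E <=
    \int[mu]_(t in `[0%R : R, 1%R]) (B t)%:E + (h e - h 1)%:E)%E.
  move=> /andP[e0 e1].
  have sub : `]e, 1[ `<=` `[0 : R, 1].
    by move=> t; rewrite /= !in_itv/= => /andP[et t1]; rewrite !ltW // (lt_trans e0).
  have sub1 : `]e, 1[ `<=` `[e, 1] by exact: subset_itv_oo_cc.
  have sub2 : `[e, 1] `<=` `[0 : R, 1].
    by move=> t; rewrite /= !in_itv/= => /andP[et ->]; rewrite (le_trans _ et) // ltW.
  have ce' : {within `[e, 1], continuous h'} by apply: ch'; rewrite e0.
  have ih' : mu.-integrable `]e, 1[ (EFin \o h').
    apply: (@integrableS _ _ _ mu `[e, 1%R]) => //.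
    apply: continuous_compact_integrable => //; exact: segment_compact.
  have iBe : mu.-integrable `]e, 1[ (EFin \o B) by exact: integrableS iB.
  have Ih' : (\int[mu]_(t in `]e, 1%R[) (h' t)%:E = (h 1 - h e)%:E)%E.
    have che : {within `[e, 1], continuous h} by exact: continuous_subspaceW ch.
    have dhe t : e < t < 1 -> is_derive t (1 : R) h (h' t).
      by move=> /andP[et t1]; apply: dh; rewrite t1 (lt_trans e0).
    rewrite -(within_FTC e1 che ce' dhe) integral_itv_bndoo //.
    exact: measurable_int ih'.
  apply: (@le_trans _ _ (\int[mu]_(t in `]e, 1%R[) ((B t)%:E - (h' t)%:E))%E).
    apply: ge0_le_integral => //.
    - by move=> t _; rewrite lee_fin.
    - by apply/measurable_EFinP; exact: measurable_funS mA.
    - by apply: emeasurable_funB; [exact: measurable_int iBe|exact: measurable_int ih'].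
    - move=> t; rewrite /= in_itv/= => /andP[et t1].
      by rewrite -EFinB lee_fin lerBrDr AB // t1 (lt_trans e0).
  rewrite integralB // Ih' -EFinN opprB leeD2r //.
  apply: ge0_subset_integral => //.
  exact/measurable_EFinP.
apply/lee_addgt0Pr => d d0.
(* The shift by 2 keeps the left end below 1, as [step] demands. *)
pose F k : set R := `]k.+2%:R^-1, 1[%classic.
have mAoo : measurable_fun `]0 : R, 1[ (EFin \o A).
  by apply/measurable_EFinP; apply: measurable_funS mA => //; exact: subset_itv_oo_cc.
have FS k : F k `<=` `]0 : R, 1[%classic.
  move=> t; rewrite /F /= !in_itv/= => /andP[kt ->]; rewrite andbT.
  by apply: lt_trans kt; rewrite invr_gt0.
have nF : nondecreasing_seq F.
  move=> k l kl; rewrite subsetEset => t; rewrite /F /= !in_itv/= => /andP[kt ->].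
  by rewrite andbT (le_lt_trans _ kt) // lef_pV2 ?posrE // ler_nat.
have UF : \bigcup_k F k = `]0 : R, 1[%classic.
  apply/seteqP; split => [t [k _]|t]; first exact: FS.
  rewrite /= in_itv/= => /andP[t0 t1]; exists (Num.truncn t^-1) => //.
  rewrite /F /= in_itv/= t1 andbT invf_plt ?posrE //.
  by apply: lt_trans (truncnS_gt _) _; rewrite ltr_nat.
have cvgF : (\int[mu]_(x in F k) (A x)%:E @[k --> \oo] -->
    \int[mu]_(x in \bigcup_k F k) (A x)%:E)%E.
  apply: ge0_nondecreasing_set_cvg_integral => //.
  - by move=> k; exact: measurable_itv.
  - by move=> k; apply: (measurable_funS _ (@FS k) mAoo).
  - by move=> k t _; rewrite lee_fin.
rewrite integral_itv_bndoo // -UF.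
rewrite -(cvg_lim _ cvgF) //; apply: lime_le.
  by apply/cvg_ex; eexists; exact: cvgF.
have [_ h0 _] := (continuous_within_itvP h (ltr01 : 0 < 1 :> R)).1 ch.
have hk : h k.+2%:R^-1 @[k --> \oo] --> h 0.
  apply: ((cvg_at_rightP _ _ _).1 h0); split=> [k|]; first by rewrite invr_gt0.
  have := @cvg_harmonic R; rewrite -(cvg_shiftS (@harmonic R)).
  exact.
near=> k.
have hkd : h k.+2%:R^-1 <= h 0 + d.
  near: k; apply: (cvgr_le _ hk); by rewrite ltrDl.
apply: le_trans (step _ _) _.
  by rewrite invr_gt0 ltr0n /= invf_lt1 // ltr1n.
by rewrite -[leRHS]addeA -EFinD; apply: leeD2l; rewrite lee_fin; lra.
Unshelve. all: by end_near. Qed.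

End IntIneq.

(** * Continuity on a subset of the line *)

Section Within.
Variables (R : realType) (A : set R).
Implicit Types f g : R -> R.

Lemma within_cst (c : R) : {within A, continuous (fun=> c)}.
Proof. by apply/subspace_continuousP => t At; exact: cvg_cst. Qed.

Lemma within_add f g : {within A, continuous f} -> {within A, continuous g} ->
  {within A, continuous (fun x => f x + g x)}.
Proof.
move=> /subspace_continuousP cf /subspace_continuousP cg.
by apply/subspace_continuousP => t At; apply: cvgD; [exact: cf|exact: cg].
Qed.

Lemma within_mul f g : {within A, continuous f} -> {within A, continuous g} ->
  {within A, continuous (fun x => f x * g x)}.
Proof.
move=> /subspace_continuousP cf /subspace_continuousP cg.
by apply/subspace_continuousP => t At; apply: cvgM; [exact: cf|exact: cg].
Qed.

Lemma within_comp f g : (forall t, A t -> {for g t, continuous f}) ->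
  {within A, continuous g} -> {within A, continuous (fun x => f (g x))}.
Proof.
move=> cf /subspace_continuousP cg; apply/subspace_continuousP => t At.
by apply: (continuous_cvg _ (cf t At)); exact: cg.
Qed.

Lemma within_sum (I : Type) (r : seq I) (F : I -> R -> R) :
  (forall k, {within A, continuous (F k)}) ->
  {within A, continuous (fun x => \sum_(k <- r) F k x)}.
Proof.
move=> cF; elim: r => [|k r IH].
  rewrite (_ : (fun x => _) = fun=> 0); first exact: within_cst.
  by apply/funext => x; rewrite big_nil.
rewrite (_ : (fun x => _) = fun x => F k x + \sum_(k <- r) F k x).
  exact: within_add.
by apply/funext => x; rewrite big_cons.
Qed.

End Within.

(** * The energy of a curve perturbed by the heat flow *)

Section Evi.
Variables (R : realType) (n : nat).
Hypothesis n0 : (0 < n)%N.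
Local Notation X := (hypercube n).
Local Notation K := (@hypercube_kernel R n).
Local Notation mu := (@lebesgue_measure R).
Implicit Types (x y : X) (i : 'I_n).

Let nn0 : n%:R != 0 :> R. Proof. by rewrite pnatr_eq0 -lt0n. Qed.

(* With w the flux of the perturbed curve and G that of the heat flow, w + G is
   tau times the transported flux c; the energy of w is expanded around that of
   w + G, and the cross term is the derivative of the entropy. *)
Lemma flux_bound_split (p tau s : R) (g : X -> R) (c E : 'I_n -> X -> R) :
  0 <= p -> (forall x, 0 < g x) -> (forall i x, c i (flip x i) = - c i x) ->
  (forall i, flux_bound g (c i) i (E i)) ->
  let w i x := tau * c i x - s / n%:R * (g (flip x i) - g x) in
  exists E' : 'I_n -> X -> R, (forall i, flux_bound g (w i) i (E' i)) /\
    p / 2 * n%:R * (\sum_i \sum_x E' i x) <=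
    tau ^+ 2 * (p / 2 * n%:R * (\sum_i \sum_x E i x)) -
    2 * s * \sum_x p * (- (\sum_i w i x) * ln (g x)).
Proof.
move=> p0 g0 cN cE w.
have wN i x : w i (flip x i) = - w i x by rewrite /w flipK cN; ring.
pose th i x := logmean (g x) (g (flip x i)).
have th0 i x : 0 < th i x by exact: logmean_gt0.
exists (fun i x => w i x ^+ 2 / th i x); split.
  move=> i; split=> x; first by rewrite divr_ge0 ?sqr_ge0 // ltW.
  by rewrite -/(th i x) mulrC divfK // gt_eqF.
have key i x : w i x ^+ 2 / th i x <= tau ^+ 2 * E i x -
    2 * s / n%:R * (w i x * (ln (g (flip x i)) - ln (g x))).
  set D := ln _ - ln _; have [E0 /(_ x) cEx] := cE i.
  have thD : th i x * D = g (flip x i) - g x.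
    by rewrite /th logmeanC ?ltW // logmean_ln.
  have wE : w i x + s / n%:R * (th i x * D) = tau * c i x.
    by rewrite thD /w subrK.
  rewrite ler_pdivrMr //.
  have h : (w i x + s / n%:R * (th i x * D)) ^+ 2 <= tau ^+ 2 * (th i x * E i x).
    by rewrite wE exprMn ler_wpM2l // sqr_ge0.
  (* In the expansion of the square of w + G the square of the heat flux is dropped, and the cross
     term is kept. *)
  have := sqr_ge0 (s / n%:R * (th i x * D)).
  by move: h; set t := s / n%:R; rewrite -[2 * s / _]mulrA -/t; nra.
have -> : \sum_x p * (- (\sum_i w i x) * ln (g x)) =
    p / 2 * \sum_x \sum_i w i x * (ln (g (flip x i)) - ln (g x)).
  rewrite (antisym_sum (fun x => ln (g x)) wN) mulrA [p / 2 * _]mulrN divfK //.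
  rewrite mulr_sumr; apply: eq_bigr => x _; ring.
have : \sum_i \sum_x w i x ^+ 2 / th i x <= \sum_i \sum_x (tau ^+ 2 * E i x -
    2 * s / n%:R * (w i x * (ln (g (flip x i)) - ln (g x)))).
  by do 2 (apply: ler_sum => ? _).
move=> /(ler_wpM2l (_ : 0 <= p / 2 * n%:R)) h; apply: le_trans (h _) _.
  by rewrite mulr_ge0 // divr_ge0.
have -> : \sum_i \sum_x (tau ^+ 2 * E i x -
    2 * s / n%:R * (w i x * (ln (g (flip x i)) - ln (g x)))) =
  tau ^+ 2 * (\sum_i \sum_x E i x) - 2 * s / n%:R *
    \sum_x \sum_i w i x * (ln (g (flip x i)) - ln (g x)).
  rewrite [X in _ - _ * X]exchange_big /= !mulr_sumr -sumrB.
  by apply: eq_bigr => i _; rewrite !mulr_sumr -sumrB.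
by rewrite le_eqVlt; apply/orP; left; apply/eqP; field.
Qed.

Definition heat (s : R) (F : X -> R) : X -> R := flow (expR (- (2 * s / n%:R))) F.

Lemma cube_divergence (rho psi : X -> R) x :
  \sum_y (psi y - psi x) * hat rho x y * K x y =
  \sum_i n%:R^-1 * (logmean (rho x) (rho (flip x i)) * (psi (flip x i) - psi x)).
Proof. by rewrite div_cube mulr_sumr. Qed.

Lemma gradient_flux_bound (rho psi : X -> R) i : (forall x, 0 <= rho x) ->
  flux_bound rho (fun x => n%:R^-1 * (logmean (rho x) (rho (flip x i)) *
      (psi (flip x i) - psi x))) i
    (fun x => n%:R^-1 ^+ 2 * (logmean (rho x) (rho (flip x i)) *
      (psi (flip x i) - psi x) ^+ 2)).
Proof.
move=> rho0; split=> x.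
  by apply: mulr_ge0; [exact: sqr_ge0|apply: mulr_ge0; [exact: logmean_ge0|exact: sqr_ge0]].
by rewrite le_eqVlt; apply/orP; left; apply/eqP; ring.
Qed.

(* The slope of tau is at most exp (2 k u) / (1 + k), so that the factor
   exp (- 2 k u) gained by the flow turns the square of the slope into a multiple
   of the slope, to which the change of variables by tau applies. *)
Lemma evi (p s : R) (m0 m1 : X -> R) (rho psi : R -> X -> R) :
  0 < s -> 0 <= p -> admissible K (fun=> p) m0 m1 rho psi ->
  (W2 K (fun=> p) m0 (heat s m1) <=
   (1 + 2 * s / n%:R)^-1%:E *
     \int[mu]_(t in `[0%R : R, 1%R]) (action K (fun=> p) (rho t) (psi t))%:E +
   (2 * s * (entropy (fun=> p) m0 - entropy (fun=> p) (heat s m1)))%:E)%E.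
Proof.
move=> s0 p0 adm; have [srho dens [rho0 rho1] mpsi cont] := adm.
pose k : R := 2 * s / n%:R.
have k0 : 0 < k by rewrite /k divr_gt0 ?mulr_gt0 // ltr0n.
pose c : R := (1 + k)^-1.
have c0 : 0 < c by rewrite invr_gt0 addr_gt0.
have ck : c * (1 + k) = 1 by rewrite mulVf // gt_eqF // addr_gt0.
pose e (u : R) : R := expR (- k * u).
pose tau (u : R) : R := c * (u + k * u ^+ 2).
pose tau' (u : R) : R := c * (1 + 2 * k * u).
have dtau (u : R) : is_derive u (1 : R) tau (tau' u).
  have d1 := is_derive_id u 1.
  apply: is_derive_eq (is_derZ c (is_derD d1 (is_derZ k (is_derX 2 d1)))) _.
  by rewrite /tau' /id; ring.
have tau0 : tau 0 = 0 by rewrite /tau expr0n /= mulr0 addr0 mulr0.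
have tau1 : tau 1 = 1 by rewrite /tau expr1n mulr1.
have tau_lt (u v : R) : 0 <= u -> u < v -> tau u < tau v.
  move=> u0 uv; have v0 := le_lt_trans u0 uv.
  rewrite ltr_pM2l // ltrD // ltr_pM2l //.
  by rewrite ltr_pXn2r // nnegrE // ltW.
have tauI (u : R) : 0 < u < 1 -> 0 < tau u < 1.
  move=> /andP[u0 u1].
  have := tau_lt 0 u (lexx 0) u0; have := tau_lt u 1 (ltW u0) u1.
  by rewrite tau0 tau1 => -> ->.
have tauI' (u : R) : 0 <= u <= 1 -> 0 <= tau u <= 1.
  move=> /andP[]; rewrite le_eqVlt => /predU1P[<- _|u0].
    by rewrite tau0 lexx ler01.
  rewrite le_eqVlt => /predU1P[->|u1]; first by rewrite tau1 lexx ler01.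
  by have /andP[? ?] := tauI u (introT andP (conj u0 u1)); rewrite !ltW.
have e01 (u : R) : 0 <= u -> 0 <= e u <= 1.
  by move=> u0; rewrite expR_ge0 -expR0 ler_expR mulNr oppr_le0 mulr_ge0 // ltW.
pose g (u : R) x := flow (e u) (rho (tau u)) x.
have sg x : smooth01 (g ^~ x).
  have sid := @smooth01_id R; have scst := @smooth01_cst R.
  apply: smooth01_flows => [|y]; first exact: smooth01_expR.
  apply: (smooth01_comp (srho y)) => [|u]; last exact: tauI'.
  apply: smooth01_mul => //; apply: smooth01_add => //; apply: smooth01_mul => //.
  exact: smooth01_mul.
have densg (u : R) : 0 <= u <= 1 -> is_density (fun=> p) (g u).
  move=> u01; have [r0 r1] := dens _ (tauI' u u01); split.
    by apply: flows_ge0 => //; apply: e01; case/andP: u01.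
  by rewrite -mulr_sumr sum_flows mulr_sumr.
have g0 : g 0 = m0.
  by apply/funext => x; rewrite /g /e mulr0 expR0 tau0 rho0 [LHS]flows1.
have g1 : g 1 = heat s m1.
  by rewrite /g /e mulr1 tau1 rho1.
(* Only [m0], at time 0, may have zeros: a positive amount of heat flow spreads mass to every
   vertex. *)
have gpos (u : R) x : 0 < u <= 1 -> 0 < g u x.
  move=> /andP[u0 u1]; have u01 : 0 <= u <= 1 by rewrite ltW.
  have [r0 r1] := dens _ (tauI' u u01).
  apply: flow_gt0 => //.
    by rewrite expR_ge0 -expR0 ltr_expR mulNr oppr_lt0 mulr_gt0.
  rewrite lt_neqAle sumr_ge0 // andbT; apply/eqP => S0.
  by move: r1; rewrite -mulr_sumr -S0 mulr0 => /esym/eqP; rewrite oner_eq0.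
pose cf (v : R) i x := n%:R^-1 * (logmean (rho v x) (rho v (flip x i)) *
  (psi v (flip x i) - psi v x)).
have cfN (v : R) i x : 0 <= v <= 1 -> cf v i (flip x i) = - cf v i x.
  by move=> /dens[r0 _]; rewrite /cf flipK logmeanC //; ring.
have drho (v : R) x : 0 < v < 1 -> is_derive v (1 : R) (rho ^~ x) (- \sum_i cf v i x).
  move=> v01; have [f' [Df _]] := smooth01_D01 (srho x).
  have dr := D01_is_derive Df v01; apply: (is_derive_eq dr).
  have := cont v x v01; rewrite cube_divergence derive1E.
  by have [_ ->] := dr; move/eqP; rewrite addr_eq0 => /eqP.
pose w (u : R) i x := tau' u * flow (e u) (cf (tau u) i) x -
  s / n%:R * (g u (flip x i) - g u x).
have fcN (u : R) i x : 0 <= u <= 1 ->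
    flow (e u) (cf (tau u) i) (flip x i) = - flow (e u) (cf (tau u) i) x.
  move=> u01; rewrite /flow -flows_flip -flowsN; congr (flows _ _ _ x).
  by apply/funext => y; rewrite cfN //; exact: tauI'.
have wN (u : R) i x : 0 < u < 1 -> w u i (flip x i) = - w u i x.
  move=> /andP[u0 u1]; rewrite /w flipK fcN ?ltW //; ring.
have dg (u : R) x : 0 < u < 1 -> is_derive u (1 : R) (g ^~ x) (- \sum_i w u i x).
  move=> u01; have de : is_derive u (1 : R) e (- k * e u).
    have d1 := is_derive_id u 1.
    apply: is_derive_eq (is_der_comp (is_derive_expR _) (is_derZ (- k) d1)) _.
    by rewrite mulr1 mulrC.
  have dF y : is_derive u (1 : R) (fun u => rho (tau u) y)
      (- tau' u * \sum_i cf (tau u) i y).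
    apply: is_derive_eq (is_der_comp (drho _ y (tauI u u01)) (dtau u)) _.
    by rewrite mulNr mulrC mulNr.
  apply: is_derive_eq (is_derive_flows (enum 'I_n) de dF x) _.
  rewrite flowsZ flows_sum big_enum /= /w [in RHS]sumrB -!mulr_sumr.
  by rewrite /k; field.
have [|||||psi' [adm' act]] := @flux_curve R n n0 p m0 (heat s m1) g w p0 sg.
- exact: densg.
- exact: g0.
- exact: g1.
- by move=> u x /andP[u0 u1]; apply: gpos; rewrite u0 ltW.
- exact: wN.
apply: le_trans (W2_le adm') _.
have /choice[gd gdP] : forall x, exists g', D01 (g ^~ x) g' /\ exists g'', D01 g' g''.
  by move=> x; exact: smooth01_D01.
have gdw u x : 0 < u < 1 -> gd x u = - \sum_i w u i x.
  move=> u01; have [Dg _] := gdP x.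
  by have [_ <-] := D01_is_derive Dg u01; have [_ <-] := dg u x u01.
pose A u := action K (fun=> p) (g u) (psi' u).
pose Ar v := action K (fun=> p) (rho v) (psi v).
pose B u := c * (tau' u * Ar (tau u)).
pose h u := 2 * s * entropy (fun=> p) (g u).
pose h' u := 2 * s * \sum_x p * ((ln (g u x) + 1) * gd x u).
have tau'0 u : 0 <= u <= 1 -> 0 <= tau' u.
  move=> /andP[u0 _]; apply: mulr_ge0; first exact: ltW.
  apply: addr_ge0 => //; apply: mulr_ge0 => //.
  by apply: mulr_ge0 => //; exact: ltW.
have ctau' : continuous tau'.
  move=> u; apply: cvgM; first exact: cvg_cst.
  apply: cvgD; first exact: cvg_cst.
  by apply: cvgM; [exact: cvg_cst|exact: cvg_id].
have mAr : measurable_fun `[0 : R, 1] Ar by exact: measurable_action adm.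
have Ar0 v : 0 <= Ar v by exact: action_ge0.
have ctau : continuous tau.
  by move=> u; apply: differentiable_continuous; apply/derivable1_diffP; have [] := dtau u.
have mArt : measurable_fun `[0 : R, 1] (fun u => Ar (tau u)).
  apply: (measurable_comp (F := `[0 : R, 1]%classic)) => //.
    by move=> _ [u u01 <-] /=; rewrite in_itv/=; apply: tauI'; move: u01; rewrite /= in_itv.
  by apply: measurable_funTS; exact: continuous_measurable_fun.
have mtA : measurable_fun `[0 : R, 1] (fun u => tau' u * Ar (tau u)).
  by apply: measurable_funM => //; apply: measurable_funTS; exact: continuous_measurable_fun.
have key : (\int[mu]_(t in `[0%R : R, 1%R]) (A t)%:E <=
   \int[mu]_(t in `[0%R : R, 1%R]) (B t)%:E + (h 0 - h 1)%:E)%E.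
  apply: (integral_le_ftc (h' := h')).
  - by move=> u; exact: action_ge0.
  - by move=> u u01; apply: mulr_ge0; [exact: ltW|apply: mulr_ge0 => //; exact: tau'0].
  - exact: measurable_action adm'.
  - exact: measurable_funM.
  - apply: within_mul; first exact: within_cst.
    apply: within_sum => x; apply: within_mul; first exact: within_cst.
    apply: (within_comp (f := fun z : R => z * ln z)) => [z _|].
      exact: continuous_xlnx.
    by have [/D01_within] := gdP x.
  - move=> d /andP[d0 d1]; apply: within_mul; first exact: within_cst.
    have sub : `[d, 1] `<=` `[0 : R, 1].
      by move=> t; rewrite /= !in_itv/= => /andP[dt ->]; rewrite (le_trans _ dt) // ltW.
    apply: within_sum => x; apply: within_mul; first exact: within_cst.
    have [Dg [g'' Dg']] := gdP x.
    apply: within_mul; last exact: continuous_subspaceW sub (D01_within Dg').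
    apply: within_add; last exact: within_cst.
    apply: (within_comp (f := @ln R)).
      move=> u; rewrite /= in_itv/= => /andP[du u1].
      by apply: continuous_ln; apply: gpos; rewrite u1 (lt_le_trans d0).
    exact: continuous_subspaceW sub (D01_within Dg).
  - move=> u u01; apply: is_derZ; apply: is_der_sum => x; apply: is_derZ.
    have gu0 : 0 < g u x by case/andP: u01 => u0 u1; apply: gpos; rewrite u0 ltW.
    apply: (is_der_comp (is_derive_xlnx gu0)).
    by apply: (D01_is_derive _ u01); have [] := gdP x.
  - move=> u u01; have /andP[u0 u1] := u01.
    have u01' : 0 <= u <= 1 by rewrite !ltW.
    have t01 := tauI u u01; have t01' := tauI' u u01'.
    have [r0 _] := dens _ t01'.
    have /choice[E EP] : forall i, exists E', flux_bound (g u) (flow (e u) (cf (tau u) i)) i E' /\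
        \sum_x E' x = e u ^+ 2 * \sum_x n%:R^-1 ^+ 2 *
         (logmean (rho (tau u) x) (rho (tau u) (flip x i)) *
          (psi (tau u) (flip x i) - psi (tau u) x) ^+ 2).
      move=> i; apply: flux_bound_flow => //; first exact: e01 (ltW u0).
        by move=> x; exact: cfN.
      exact: gradient_flux_bound.
    have gu0 x : 0 < g u x by apply: gpos; rewrite u0 ltW.
    have [E' [wE' E'le]] := flux_bound_split (tau' u) s p0 gu0 (fun i x => fcN u i x u01')
       (fun i => (EP i).1).
    have Ale := act u E' u01 wE'.
    (* The constant 1 in the derivative of x ln x contributes nothing, since the divergence of an
       odd flux has zero sum. *)
    have h'E : h' u = 2 * s * \sum_x p * (- (\sum_i w u i x) * ln (g u x)).
      congr (_ * _); rewrite (eq_bigr (fun x => p * (- (\sum_i w u i x) * ln (g u x)) -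
          p * \sum_i w u i x)) => [|x _].
        rewrite sumrB -[X in _ - X]mulr_sumr antisym_sum0; first by rewrite mulr0 subr0.
        by move=> i x; exact: wN.
      by rewrite gdw //; ring.
    have SE : p / 2 * n%:R * (\sum_i \sum_x E i x) = e u ^+ 2 * Ar (tau u).
      rewrite (eq_bigr (fun i => e u ^+ 2 * (n%:R^-1 ^+ 2 * \sum_x
         (logmean (rho (tau u) x) (rho (tau u) (flip x i)) *
          (psi (tau u) (flip x i) - psi (tau u) x) ^+ 2)))) => [|i _].
        by rewrite /Ar action_cube // -!mulr_sumr exchange_big /=; field.
      by rewrite (EP i).2 -mulr_sumr.
    rewrite -lerBrDr; apply: le_trans Ale _; apply: le_trans E'le _.
    rewrite h'E SE lerD2r mulrA /B mulrA ler_wpM2r //.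
    rewrite expr2 -mulrA [leRHS]mulrC ler_wpM2l ?tau'0 //.
    rewrite /tau' -mulrA -[leRHS]mulr1 ler_wpM2l ?(ltW c0) //.
    rewrite /e -expRM_natl.
    have -> : 2%:R * (- k * u) = - (2 * k * u) by ring.
    by rewrite expRN ler_pdivrMr ?expR_gt0 // mul1r expR_ge1Dx.
apply: le_trans key _; rewrite leeD //; last first.
  by rewrite lee_fin /h g0 g1 mulrBr.
have subst : (\int[mu]_(x in `[0%R : R, 1%R]) (tau' x * Ar (tau x))%:E =
    \int[mu]_(y in `[0%R : R, 1%R]) (Ar y)%:E)%E.
  apply: ge0_integral_subst01 => //.
    by move=> u /andP[u0 u1]; apply: tau'0; rewrite u1 ltW.
  by move=> u v u0 uv _; exact: tau_lt.
rewrite -subst -ge0_integralZl //.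
- exact/measurable_EFinP.
- by move=> u; rewrite /= in_itv/= => u01; rewrite lee_fin mulr_ge0 // tau'0.
- by rewrite lee_fin ltW.
Qed.

End Evi.

(** * Gluing curves *)

Section Ramp.
Variables (R : realType) (eps t : R).
Hypotheses (eps0 : 0 < eps) (t01 : 0 < t < 1).
Local Notation mu := (@lebesgue_measure R).

Let t0 : 0 < t. Proof. by case/andP: t01. Qed.
Let t1 : t < 1. Proof. by case/andP: t01. Qed.

(* Runs from 0 to 1 on [0, t], stops there with all derivatives zero, and has
   slope at most exp eps / t. *)
Definition ramp (u : R) : R := 1 - flatT eps (1 - t^-1 * u).
Definition ramp' (u : R) : R := t^-1 * flatT' eps (1 - t^-1 * u).

Lemma is_derive_ramp u : is_derive u (1 : R) ramp (ramp' u).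
Proof.
have d1 := is_derive_id u 1.
have dl := is_derB (is_derC 1 u) (is_derZ t^-1 d1).
apply: is_derive_eq (is_derB (is_derC 1 u)
  (is_der_comp (is_derive_flatT eps0 _) dl)) _.
by rewrite /ramp'; ring.
Qed.

Lemma smooth01_ramp : smooth01 ramp.
Proof.
apply: smooth01_add; first exact: smooth01_cst.
apply: smooth01_opp; apply: smooth01_ext (smooth01_flatT eps0 1 (- t^-1)).
by move=> u _; rewrite mulNr.
Qed.

Lemma ramp0 : ramp 0 = 0.
Proof. by rewrite /ramp mulr0 subr0 flatT1 subrr. Qed.

Lemma ramp_ge u : t <= u -> ramp u = 1.
Proof.
move=> tu; rewrite /ramp flatT_le0 ?subr0 // subr_le0.
by rewrite mulrC ler_pdivlMr // mul1r.
Qed.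

Lemma ramp'_ge u : t <= u -> ramp' u = 0.
Proof.
move=> tu; rewrite /ramp' flatT'_le0 ?mulr0 // subr_le0.
by rewrite mulrC ler_pdivlMr // mul1r.
Qed.

Lemma ramp_lt u v : u < v -> v <= t -> ramp u < ramp v.
Proof.
move=> uv vt; rewrite /ramp ltrD2l ltrN2; apply: flatT_lt => //.
  by rewrite subr_ge0 mulrC ler_pdivrMr // mul1r.
by rewrite ltrD2l ltrN2 ltr_pM2l // invr_gt0.
Qed.

Lemma ramp_oo u : 0 < u < t -> 0 < ramp u < 1.
Proof.
move=> /andP[u0 ut]; have := ramp_lt u0 (ltW ut); have := ramp_lt ut (lexx t).
by rewrite ramp0 (ramp_ge (lexx t)) => -> ->.
Qed.

Lemma ramp_itv u : 0 <= u -> 0 <= ramp u <= 1.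
Proof.
rewrite le_eqVlt => /predU1P[<-|u0]; first by rewrite ramp0 lexx ler01.
have [tu|ut] := leP t u; first by rewrite ramp_ge // lexx ler01.
by have /andP[/ltW -> /ltW ->] := ramp_oo (introT andP (conj u0 ut)).
Qed.

Lemma ramp'_ge0 u : 0 <= ramp' u.
Proof. by rewrite mulr_ge0 ?flatT'_ge0 // invr_ge0 ltW. Qed.

Lemma ramp'_le u : ramp' u <= expR eps / t.
Proof. by rewrite /ramp' mulrC ler_wpM2r ?flatT'_le // invr_ge0 ltW. Qed.

Lemma continuous_ramp' : continuous ramp'.
Proof.
have cE k : continuous (flatE eps k).
  move=> w; apply: differentiable_continuous; apply/derivable1_diffP.
  by have [] := is_derive_flatE eps0 k w.
have cT : continuous (flatT' eps).
  move=> w; apply: cvgM; first exact: cvg_cst.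
  apply: cvgD; first exact: cE.
  by apply: cvgM; [exact: cvg_cst|exact: cE].
move=> u; apply: cvgM; first exact: cvg_cst.
apply: (continuous_cvg _ (cT (1 - t^-1 * u))).
apply: cvgB; first exact: cvg_cst.
by apply: cvgM; [exact: cvg_cst|exact: cvg_id].
Qed.

Lemma continuous_ramp : continuous ramp.
Proof.
move=> w; apply: differentiable_continuous; apply/derivable1_diffP.
by have [] := is_derive_ramp w.
Qed.

Lemma measurable_ramp_comp (f : R -> R) : measurable_fun `[0 : R, 1] f ->
  measurable_fun `[0 : R, 1] (fun u => f (ramp u)).
Proof.
move=> mf; apply: (measurable_comp (F := `[0 : R, 1]%classic)) => //.
  move=> _ [u u01 <-] /=; rewrite in_itv/=; apply: ramp_itv.
  by move: u01; rewrite /= in_itv/= => /andP[].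
apply: measurable_funTS; apply: continuous_measurable_fun; exact: continuous_ramp.
Qed.

Lemma measurable_ramp'_comp (f : R -> R) : measurable_fun `[0 : R, 1] f ->
  measurable_fun `[0 : R, 1] (fun u => ramp' u * f (ramp u)).
Proof.
move=> mf; apply: measurable_funM; last exact: measurable_ramp_comp.
apply: measurable_funTS; apply: continuous_measurable_fun.
exact: continuous_ramp'.
Qed.

Lemma integral_ramp (A : R -> R) :
  measurable_fun `[0 : R, 1] A -> (forall x, 0 <= A x) ->
  (\int[mu]_(u in `[0%R : R, 1%R]) (ramp' u * A (ramp u))%:E =
   \int[mu]_(y in `[0%R : R, 1%R]) (A y)%:E)%E.
Proof.
move=> mA A0.
transitivity (\int[mu]_(u in `[0%R, t]) (ramp' u * A (ramp u))%:E)%E; last first.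
  have incr u v : 0 <= u -> u < v -> v <= t -> ramp u < ramp v.
    by move=> _; exact: ramp_lt.
  exact: (@ge0_integral_subst01 R 0 t ramp ramp' t0 is_derive_ramp continuous_ramp'
    (fun u _ => ramp'_ge0 u) incr A ramp0 (ramp_ge (lexx t)) mA A0).
have -> : `[0, t]%classic = `[0, 1] `&` `[0, t]%classic :> set R.
  by apply/esym/setIidr; apply: subset_itvl; rewrite bnd_simp ltW.
rewrite [RHS]integral_mkcondr; apply: eq_integral => u /set_mem.
rewrite /= in_itv/= => /andP[u0 u1]; rewrite patchE.
case: ifPn => //; rewrite notin_setE /= in_itv/= u0 /= => /negP.
by rewrite -ltNge => tu; rewrite ramp'_ge ?mul0r // ltW.
Qed.

End Ramp.

Section Glue.
Variables (R : realType) (n : nat).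
Hypothesis n0 : (0 < n)%N.
Local Notation X := (hypercube n).
Local Notation K := (@hypercube_kernel R n).
Local Notation mu := (@lebesgue_measure R).
Implicit Types (x y : X) (i : 'I_n).

Lemma integral01_onem (f : R -> R) : measurable_fun `[0 : R, 1] f ->
  (forall u, 0 <= f u) ->
  (\int[mu]_(u in `[0%R : R, 1%R]) (f (1 - u))%:E =
   \int[mu]_(u in `[0%R : R, 1%R]) (f u)%:E)%E.
Proof.
move=> mf f0; pose h : R -> \bar R := (EFin \o f) \_ `[0, 1].
have mh : measurable_fun setT h.
  by apply/(measurable_restrictT _ _).1 => //; exact/measurable_EFinP.
have h0 (u : R) : (0 <= h u)%E.
  by rewrite /h patchE; case: ifP => // _; rewrite lee_fin.
have := ge0_integral_reflect 1 0 1 mh h0; rewrite subr0 subrr => e.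
transitivity (\int[mu]_(u in `[0%R : R, 1%R]) h (1 - u)%R)%E.
  apply: eq_integral => u /set_mem; rewrite /= in_itv/= => /andP[u0 u1].
  by rewrite /h patchE mem_set //= in_itv/= subr_ge0 u1 lerBlDr lerDl.
by rewrite e; apply: eq_integral => u uI; rewrite /h patchE uI.
Qed.

Lemma integral01_le_add (A C D : R -> R) (c d : R) :
  measurable_fun `[0 : R, 1] A -> measurable_fun `[0 : R, 1] C ->
  measurable_fun `[0 : R, 1] D ->
  (forall u, 0 <= A u) -> (forall u, 0 <= C u) -> (forall u, 0 <= D u) ->
  0 <= c -> 0 <= d -> (forall u : R, 0 <= u <= 1 -> A u <= c * C u + d * D u) ->
  (\int[mu]_(u in `[0%R : R, 1%R]) (A u)%:E <=
   c%:E * \int[mu]_(u in `[0%R : R, 1%R]) (C u)%:E +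
   d%:E * \int[mu]_(u in `[0%R : R, 1%R]) (D u)%:E)%E.
Proof.
move=> mA mC mD A0 C0 D0 c0 d0 le_A.
have mC' := (measurable_EFinP _ _).2 mC; have mD' := (measurable_EFinP _ _).2 mD.
rewrite -!ge0_integralZl //; try by move=> u _; rewrite lee_fin.
rewrite -ge0_integralD //; try by move=> u _; rewrite mule_ge0 // lee_fin.
- apply: ge0_le_integral => //.
  + by move=> u _; rewrite lee_fin.
  + exact/measurable_EFinP.
  + by apply: emeasurable_funD; exact: measurable_funeM.
- exact: measurable_funeM.
- exact: measurable_funeM.
Qed.

Lemma actionZ (p c : R) (rho psi : X -> R) :
  action K (fun=> p) rho (fun x => c * psi x) = c ^+ 2 * action K (fun=> p) rho psi.
Proof.
rewrite !action_cube // mulrCA; congr (_ * _); rewrite mulr_sumr.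
apply: eq_bigr => x _; rewrite mulr_sumr; apply: eq_bigr => i _; ring.
Qed.

(* Up to the time t only a moves, and afterwards only b, backwards; both are at
   rest in m to infinite order at the time t, hence the sum a + b - m is smooth. *)
Lemma W2_glue (p t eps : R) (m0 m1 m : X -> R) (a psia b psib : R -> X -> R) :
  0 <= p -> 0 < t < 1 -> 0 < eps ->
  admissible K (fun=> p) m0 m a psia -> admissible K (fun=> p) m1 m b psib ->
  (W2 K (fun=> p) m0 m1 <=
   (expR eps / t)%:E *
     \int[mu]_(u in `[0%R : R, 1%R]) (action K (fun=> p) (a u) (psia u))%:E +
   (expR eps / (1 - t))%:E *
     \int[mu]_(u in `[0%R : R, 1%R]) (action K (fun=> p) (b u) (psib u))%:E)%E.
Proof.
move=> p0 t01 eps0 adma admb.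
have [sa da [a0 a1] mpa conta] := adma; have [sb db [b0 b1] mpb contb] := admb.
have /andP[t0 t1] := t01.
have t01' : 0 < 1 - t < 1 by rewrite subr_gt0 t1 ltrBlDr ltrDl.
pose al (u : R) := ramp eps t u; pose al' (u : R) := ramp' eps t u.
pose be (u : R) := ramp eps (1 - t) (1 - u).
pose be' (u : R) := - ramp' eps (1 - t) (1 - u).
have alI (u : R) : 0 <= u <= 1 -> 0 <= al u <= 1 by case/andP => u0 _; exact: ramp_itv.
have beI (u : R) : 0 <= u <= 1 -> 0 <= be u <= 1.
  by case/andP => u0 u1; apply: ramp_itv => //; rewrite subr_ge0.
have al_ge u : t <= u -> al u = 1 by exact: ramp_ge.
have al'_ge u : t <= u -> al' u = 0 by exact: ramp'_ge.
have be_le u : u <= t -> be u = 1.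
  by move=> ut; apply: ramp_ge => //; rewrite lerD2l lerN2.
have be'_le u : u <= t -> be' u = 0.
  by move=> ut; rewrite /be' ramp'_ge ?oppr0 // lerD2l lerN2.
pose g (u : R) x : R := a (al u) x + b (be u) x - m x.
pose psi (u : R) x : R := al' u * psia (al u) x + be' u * psib (be u) x.
have gl u : u <= t -> g u = a (al u).
  by move=> ut; apply/funext => x; rewrite /g be_le // b1 addrK.
have gr u : t <= u -> g u = b (be u).
  by move=> ut; apply/funext => x; rewrite /g al_ge // a1 addrAC subrr add0r.
have psil u : u <= t -> psi u = fun x => al' u * psia (al u) x.
  by move=> ut; apply/funext => x; rewrite /psi be'_le // mul0r addr0.
have psir u : t <= u -> psi u = fun x => be' u * psib (be u) x.
  by move=> ut; apply/funext => x; rewrite /psi al'_ge // mul0r add0r.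
have dal (u : R) : is_derive u (1 : R) al (al' u) by exact: is_derive_ramp.
have dbe (u : R) : is_derive u (1 : R) be (be' u).
  have d1 : is_derive u (1 : R) (fun v => 1 - v) (- 1).
    by apply: is_derive_eq (is_derB (is_derC 1 u) (is_derive_id u 1)) _; rewrite sub0r.
  by have := @is_der_comp R (ramp eps (1 - t)) (fun v => 1 - v) u _ _
    (is_derive_ramp (1 - t) eps0 _) d1; rewrite mulrN1.
have sal : smooth01 al by exact: smooth01_ramp.
have sbe : smooth01 be.
  apply: (smooth01_comp (smooth01_ramp (1 - t) eps0)).
    apply: smooth01_add; first exact: smooth01_cst.
    by apply: smooth01_opp; exact: smooth01_id.
  by move=> u /andP[u0 u1]; apply/andP; split; lra.
(* When one of the curves rests at parameter 1, its two-sided derivative [derive1] there carries no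
   information, but the factor [al' u] or [be' u] is 0. *)
have dg x (u : R) : 0 < u < 1 -> is_derive u (1 : R) (g ^~ x)
    (derive1 (a ^~ x) (al u) * al' u + derive1 (b ^~ x) (be u) * be' u).
  move=> u01; have [f' [Df _]] := smooth01_D01 (sa x).
  have [h' [Dh _]] := smooth01_D01 (sb x).
  have Da := D01_comp Df (is_derive_D01 dal) alI.
  have Db := D01_comp Dh (is_derive_D01 dbe) beI.
  have Dg := D01_add (D01_add Da Db) (D01_cst (- m x)).
  apply: (is_derive_eq (D01_is_derive Dg u01)); rewrite addr0.
  have /andP[u0 u1] := u01.
  have [ut|tu|ut] := ltgtP u t.
  - rewrite be'_le ?ltW // !mulr0; congr (_ * _ + _).
    have al01 : 0 < al u < 1 by apply: ramp_oo; rewrite // u0.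
    by rewrite derive1E; have [_ ->] := D01_is_derive Df al01.
  - rewrite al'_ge ?ltW // !mulr0; congr (_ + _ * _).
    have be01 : 0 < be u < 1.
      by apply: ramp_oo => //; rewrite subr_gt0 u1 ltrD2l ltrN2.
    by rewrite derive1E; have [_ ->] := D01_is_derive Dh be01.
  - by rewrite be'_le ?al'_ge ?ut // !mulr0.
have adm : admissible K (fun=> p) m0 m1 g psi.
  split.
  - move=> x; apply: smooth01_add; last exact: smooth01_cst.
    apply: smooth01_add; first exact: (smooth01_comp (sa x) sal alI).
    exact: (smooth01_comp (sb x) sbe beI).
  - move=> u u01; have [ut|tu] := leP u t.
      by rewrite gl //; apply: da; exact: alI.
    by rewrite gr ?ltW //; apply: db; exact: beI.
  - split; first by rewrite gl ?ltW // /al ramp0.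
    by rewrite gr ?ltW // /be subrr ramp0.
  - move=> x; apply: measurable_funD; apply: measurable_funM.
    + apply: measurable_funTS; apply: continuous_measurable_fun.
      exact: continuous_ramp'.
    + exact: (measurable_ramp_comp eps0 t01 (mpa x)).
    + apply: measurable_funTS; apply: continuous_measurable_fun => u.
      apply: cvgN; apply: (continuous_cvg _ (@continuous_ramp' R eps (1 - t) eps0 (1 - u))).
      by apply: cvgB; [exact: cvg_cst|exact: cvg_id].
    + apply: (@measurable_comp _ _ _ R R R `[0 : R, 1]%classic (psib ^~ x) _ be) => //.
        move=> _ [u u01 <-] /=; rewrite in_itv/=; apply: beI.
        by move: u01; rewrite /= in_itv.
      apply: measurable_funTS; apply: continuous_measurable_fun => u.
      apply: differentiable_continuous; apply/derivable1_diffP.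
      by have [] := dbe u.
  - move=> u x u01; rewrite derive1E; have [_ ->] := dg x u u01.
    have /andP[u0 u1] := u01.
    have [ut|tu|ut] := ltgtP u t.
    + have al01 : 0 < al u < 1 by apply: ramp_oo; rewrite // u0.
      rewrite gl ?psil ?be'_le ?ltW // mulr0 addr0.
      rewrite -[RHS](mulr0 (al' u)) -[X in _ = _ * X](conta _ x al01) mulrDr.
      congr (_ + _); first by rewrite mulrC.
      by rewrite mulr_sumr; apply: eq_bigr => y _; ring.
    + have be01 : 0 < be u < 1.
        by apply: ramp_oo => //; rewrite subr_gt0 u1 ltrD2l ltrN2.
      rewrite gr ?psir ?al'_ge ?ltW // mulr0 add0r.
      rewrite -[RHS](mulr0 (be' u)) -[X in _ = _ * X](contb _ x be01) mulrDr.
      congr (_ + _); first by rewrite mulrC.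
      by rewrite mulr_sumr; apply: eq_bigr => y _; ring.
    + rewrite psil ?al'_ge ?be'_le ?ut // !mulr0 !add0r big1 // => y _.
      by rewrite !mul0r subrr !mul0r.
apply: le_trans (W2_le adm) _.
pose Aa u := action K (fun=> p) (a u) (psia u).
pose Ab u := action K (fun=> p) (b u) (psib u).
have Aa0 u : 0 <= Aa u by exact: action_ge0.
have Ab0 u : 0 <= Ab u by exact: action_ge0.
have mAa : measurable_fun `[0 : R, 1] Aa by exact: measurable_action adma.
have mAb : measurable_fun `[0 : R, 1] Ab by exact: measurable_action admb.
pose C u := al' u * Aa (al u).
pose C2 (v : R) := ramp' eps (1 - t) v * Ab (ramp eps (1 - t) v).
have C0 u : 0 <= C u by apply: mulr_ge0; [exact: ramp'_ge0|exact: Aa0].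
have C20 u : 0 <= C2 u by apply: mulr_ge0; [exact: ramp'_ge0|exact: Ab0].
have mC : measurable_fun `[0 : R, 1] C by exact: (measurable_ramp'_comp eps0 t01 mAa).
have mC2 : measurable_fun `[0 : R, 1] C2 by exact: (measurable_ramp'_comp eps0 t01' mAb).
have mC2r : measurable_fun `[0 : R, 1] (fun u => C2 (1 - u)).
  apply: (@measurable_comp _ _ _ R R R `[0 : R, 1]%classic C2 _ (fun u => 1 - u)) => //.
    move=> _ [u u01 <-]; move: u01; rewrite /= !in_itv/= => /andP[u0 u1].
    by apply/andP; split; lra.
  exact: measurable_funB.
have e1 : 0 <= expR eps / t by rewrite divr_ge0 ?expR_ge0 // ltW.
have e2 : 0 <= expR eps / (1 - t) by rewrite divr_ge0 ?expR_ge0 // subr_ge0 ltW.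
(* One factor of the squared speed is bounded by the maximal slope of the ramp; the other one is
   used up by the substitution. *)
have sq (c r M : R) : 0 <= c <= r -> 0 <= M -> c ^+ 2 * M <= r * (c * M).
  by move=> /andP[c0 cr] M0; rewrite expr2 mulrA ler_wpM2r // ler_wpM2r.
have le_C (u : R) : 0 <= u <= 1 -> action K (fun=> p) (g u) (psi u) <=
    expR eps / t * C u + expR eps / (1 - t) * C2 (1 - u).
  move=> _; have [ut|/ltW tu] := leP u t.
    rewrite (gl _ ut) (psil _ ut) actionZ -[leLHS]addr0; apply: lerD.
      by apply: sq; [rewrite ramp'_ge0 // ramp'_le|exact: Aa0].
    exact: mulr_ge0 e2 (C20 _).
  rewrite (gr _ tu) (psir _ tu) actionZ -[leLHS]add0r; apply: lerD.
    exact: mulr_ge0 e1 (C0 _).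
  by rewrite /be' sqrrN; apply: sq; [rewrite ramp'_ge0 // ramp'_le|exact: Ab0].
apply: le_trans (integral01_le_add (measurable_action adm) mC mC2r
  (fun u => action_ge0 n0 _ _ p0) C0 (fun u => C20 _) e1 e2 le_C) _.
rewrite le_eqVlt; apply/orP; left; apply/eqP.
congr (_ * _ + _ * _)%E; first exact: (integral_ramp eps0 t01 mAa Aa0).
exact: (etrans (integral01_onem mC2 C20) (integral_ramp eps0 t01' mAb Ab0)).
Qed.

End Glue.

(** * Convexity of the entropy along geodesics *)

Section Final.
Variables (R : realType) (n : nat).
Hypothesis n0 : (0 < n)%N.
Local Notation X := (hypercube n).
Local Notation K := (@hypercube_kernel R n).
Local Notation mu := (@lebesgue_measure R).
Implicit Types (x y : X) (i : 'I_n).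

Lemma W2_ge0 (p : R) (m0 m1 : X -> R) : 0 <= p -> (0 <= W2 K (fun=> p) m0 m1)%E.
Proof.
move=> p0; apply: le_ereal_inf_tmp => _ [rho [psi [_ ->]]].
by apply: integral_ge0 => t _; rewrite lee_fin action_ge0.
Qed.

Lemma W2_admissible (p v d : R) (m0 m1 : X -> R) :
  (W2 K (fun=> p) m0 m1 <= v%:E)%E -> 0 < d -> exists rho psi,
    admissible K (fun=> p) m0 m1 rho psi /\
    (\int[mu]_(t in `[0%R : R, 1%R]) (action K (fun=> p) (rho t) (psi t))%:E
      <= (v + d)%:E)%E.
Proof.
move=> Wv d0.
have /ereal_inf_lt[_ [rho [psi [adm ->]]] /ltW h] : (W2 K (fun=> p) m0 m1 < (v + d)%:E)%E.
  by apply: le_lt_trans Wv _; rewrite lte_fin ltrDl.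
by exists rho, psi.
Qed.

Lemma W2_evi (p s v : R) (m0 m1 : X -> R) : 0 <= p -> 0 < s ->
  (W2 K (fun=> p) m0 m1 <= v%:E)%E ->
  (W2 K (fun=> p) m0 (heat s m1) <=
   ((1 + 2 * s / n%:R)^-1 * v +
    2 * s * (entropy (fun=> p) m0 - entropy (fun=> p) (heat s m1)))%:E)%E.
Proof.
move=> p0 s0 Wv; apply/lee_addgt0Pr => d d0.
have [rho [psi [adm h]]] := W2_admissible Wv d0.
have k0 : 0 <= 2 * s / n%:R by rewrite divr_ge0 // mulr_ge0 // ltW.
have c1 : (1 + 2 * s / n%:R)^-1 <= 1 by rewrite invf_le1 ?lerDl // ltr_pwDl.
have c0 : 0 <= (1 + 2 * s / n%:R)^-1 by rewrite invr_ge0 addr_ge0.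
apply: le_trans (evi n0 s0 p0 adm) _.
rewrite -EFinD addrAC EFinD leeD2r //.
apply: le_trans (lee_wpmul2l _ h) _; first by rewrite lee_fin.
by rewrite -EFinM lee_fin mulrDr lerD2l ler_piMl // ltW.
Qed.

(** The weighted form of the squared triangle inequality. A single parameter [e] measures both the
    steepness of the ramps and the distance of the curves from optimality, and tends to 0. *)
Lemma W2_glue_le (p t w va vb : R) (m0 m1 m : X -> R) : 0 <= p -> 0 < t < 1 ->
  W2 K (fun=> p) m0 m1 = w%:E ->
  (W2 K (fun=> p) m0 m <= va%:E)%E -> (W2 K (fun=> p) m1 m <= vb%:E)%E ->
  w <= va / t + vb / (1 - t).
Proof.
move=> p0 t01 Ww Wa Wb; have /andP[t0 t1] := t01.
pose f (e : R) := expR e * ((va + e) / t + (vb + e) / (1 - t)).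
have wf e : 0 < e -> w <= f e.
  move=> e0; have [a [psia [adma ha]]] := W2_admissible Wa e0.
  have [b [psib [admb hb]]] := W2_admissible Wb e0.
  rewrite -lee_fin -Ww; apply: le_trans (W2_glue n0 p0 t01 e0 adma admb) _.
  have e1 : 0 <= expR e / t by rewrite divr_ge0 ?expR_ge0 // ltW.
  have e2 : 0 <= expR e / (1 - t) by rewrite divr_ge0 ?expR_ge0 // subr_ge0 ltW.
  apply: le_trans (leeD (lee_wpmul2l _ ha) (lee_wpmul2l _ hb)) _;
    [by rewrite lee_fin|by rewrite lee_fin|].
  rewrite -!EFinM -EFinD lee_fin le_eqVlt; apply/orP; left; apply/eqP.
  by rewrite /f; field; rewrite gt_eqF ?subr_gt0 // gt_eqF.
have f0 : f 0 = va / t + vb / (1 - t) by rewrite /f expR0 mul1r !addr0.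
have cf : f e @[e --> (0 : R)] --> f 0.
  apply: cvgM; first exact: continuous_expR.
  apply: cvgD; (apply: cvgM; last exact: cvg_cst);
    by apply: cvgD; [exact: cvg_cst|exact: cvg_id].
rewrite -f0 leNgt; apply/negP => f0w.
have cfr : f e @[e --> (0 : R)^'+] --> f 0 by exact: cvg_at_right_filter.
near (0 : R)^'+ => e.
have /wf : 0 < e by near: e; exact: nbhs_right_gt.
by rewrite leNgt => /negP; apply; near: e; exact: (cvgr_lt _ cfr).
Unshelve. all: by end_near. Qed.

Lemma continuous_flows l (F : X -> R) x : continuous (fun e : R => flows e l F x).
Proof.
elim: l x => [|j l IH] x e; first exact: cvg_cst.
apply: cvgD; (apply: cvgM; last exact: IH); (apply: cvgM; last exact: cvg_cst).
  by apply: cvgD; [exact: cvg_cst|exact: cvg_id].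
by apply: cvgB; [exact: cvg_cst|exact: cvg_id].
Qed.

Lemma heat0 (F : X -> R) : heat 0 F = F.
Proof.
apply/funext => x; rewrite /heat mulr0 mul0r oppr0 expR0; exact: flows1.
Qed.

Lemma cvg_entropy_heat (p : R) (F : X -> R) :
  entropy (fun=> p) (heat s F) @[s --> (0 : R)] --> entropy (fun=> p) F.
Proof.
rewrite -[X in _ --> entropy _ X]heat0 /entropy.
have cs x : heat s F x @[s --> (0 : R)] --> heat 0 F x.
  apply: (continuous_cvg _ (@continuous_flows (enum 'I_n) F x _)).
  apply: (continuous_cvg _ (@continuous_expR R _)).
  apply: cvgN; apply: cvgM; last exact: cvg_cst.
  by apply: cvgM; [exact: cvg_cst|exact: cvg_id].
apply: cvg_big => [|x _]; last first.
  apply: cvgM; first exact: cvg_cst.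
  exact: (continuous_cvg _ (@continuous_xlnx R _) (cs x)).
exact: add_continuous.
Qed.

Lemma geodesic_W2 (p : R) (rho : R -> X -> R) (r t d : R) : 0 <= p ->
  is_geodesic K (fun=> p) rho -> 0 <= r <= 1 -> 0 <= t <= 1 ->
  W2 K (fun=> p) (rho 0) (rho 1) = d%:E ->
  W2 K (fun=> p) (rho r) (rho t) = ((r - t) ^+ 2 * d)%:E.
Proof.
move=> p0 [_ geo] r01 t01 Wd.
have := congr1 (fun z => z ^+ 2)%E (geo r t r01 t01).
rewrite /W sqr_sqrte ?W2_ge0 // => ->; rewrite Wd.
have d0 : 0 <= d by rewrite -lee_fin -Wd W2_ge0.
rewrite /= -!EFinM; congr EFin.
by rewrite mulrACA -!expr2 real_normK ?num_real // sqr_sqrtr.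
Qed.

Lemma Ric_ge_hypercube (p : R) : 0 <= p -> is_density (fun=> p) (fun _ : X => 1) ->
  Ric_ge K (fun=> p) (2 / n%:R).
Proof.
move=> p0 dens1 rho geo t t01.
have [densr geoW] := geo.
have i0 : 0 <= (0 : R) <= 1 by rewrite lexx ler01.
have i1 : 0 <= (1 : R) <= 1 by rewrite lexx ler01.
have /fineK Wd : W2 K (fun=> p) (rho 0) (rho 1) \is a fin_num.
  rewrite ge0_fin_numE ?W2_ge0 //.
  by apply: W2_lty => //; exact: densr.
set d := fine _ in Wd; have {}Wd := esym Wd.
have WW : (W K (fun=> p) (rho 0%R) (rho 1%R) ^+ 2 = d%:E)%E.
  by rewrite /W sqr_sqrte ?W2_ge0.
rewrite WW -EFinM -EFinB lee_fin.
(* Gluing divides by t and 1 - t, so the ends are treated apart; the claim is an equality there. *)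
have /andP[] := t01; rewrite le_eqVlt => /predU1P[<- _|t0].
  by rewrite subr0 mul1r mul0r addr0 mulr0 !mul0r subr0.
rewrite le_eqVlt => /predU1P[->|t1].
  by rewrite subrr mul0r add0r mul1r !mulr0 mul0r subr0.
have t01' : 0 < t < 1 by rewrite t0.
pose H (F : X -> R) : R := entropy (fun=> p) F; pose M := (1 - t) * H (rho 0) + t * H (rho 1).
have n0' : 0 < n%:R :> R by rewrite ltr0n.
have key s : 0 < s -> (n%:R + 2 * s)^-1 * (t * (1 - t) * d) + H (heat s (rho t)) <= M.
  move=> s0.
  have evi_le r : 0 <= r <= 1 -> (W2 K (fun=> p) (rho r) (heat s (rho t)) <=
      ((1 + 2 * s / n%:R)^-1 * ((r - t) ^+ 2 * d) +
       2 * s * (H (rho r) - H (heat s (rho t))))%:E)%E.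
    by move=> r01; apply: W2_evi => //; rewrite (geodesic_W2 p0 geo r01 t01 Wd).
  have := W2_glue_le p0 t01' Wd (evi_le _ i0) (evi_le _ i1).
  set h := H (heat s (rho t)); set c := (1 + _)^-1.
  have t1' : 0 < 1 - t by rewrite subr_gt0.
  rewrite -(ler_pM2l (mulr_gt0 t0 t1')).
  have -> : t * (1 - t) * ((c * ((0 - t) ^+ 2 * d) + 2 * s * (H (rho 0) - h)) / t +
     (c * ((1 - t) ^+ 2 * d) + 2 * s * (H (rho 1) - h)) / (1 - t)) =
     c * (t * (1 - t) * d) + 2 * s * (M - h).
    by rewrite /M; field; rewrite !gt_eqF.
  (* The contraction lowers the factor of t (1 - t) d from 1 to [c]; divided by 2 s, the gain tends
     to 1 / n, half of the curvature bound. *)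
  have cE : (n%:R + 2 * s)^-1 = (1 - c) / (2 * s).
    by rewrite /c; field; rewrite !gt_eqF //= ?addr_gt0 ?mulr_gt0.
  rewrite cE -lerBlDl => hc; rewrite -lerBrDr mulrAC ler_pdivrMr ?mulr_gt0 //.
  by rewrite [leRHS]mulrC mulrBl mul1r.
pose Phi s := (n%:R + 2 * s)^-1 * (t * (1 - t) * d) + H (heat s (rho t)).
have cPhi : Phi s @[s --> (0 : R)] --> n%:R^-1 * (t * (1 - t) * d) + H (rho t).
  apply: cvgD; last exact: cvg_entropy_heat.
  apply: cvgM; last exact: cvg_cst.
  apply: cvgV; first by rewrite gt_eqF.
  rewrite -[X in _ --> X]addr0 -[X in _ --> _ + X](mulr0 2).
  apply: cvgD; first exact: cvg_cst.
  by apply: cvgM; [exact: cvg_cst|exact: cvg_id].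
have lim : n%:R^-1 * (t * (1 - t) * d) + H (rho t) <= M.
  rewrite leNgt; apply/negP => ltM.
  have cPhir : Phi s @[s --> (0 : R)^'+] --> n%:R^-1 * (t * (1 - t) * d) + H (rho t).
    exact: cvg_at_right_filter.
  near (0 : R)^'+ => s.
  have /key : 0 < s by near: s; exact: nbhs_right_gt.
  by rewrite leNgt => /negP; apply; near: s; exact: (cvgr_gt _ cPhir).
rewrite -/(H _) -/(H (rho 0)) -/(H (rho 1)) -/M lerBrDl.
have -> : 2 / n%:R / 2 * t * (1 - t) * d = n%:R^-1 * (t * (1 - t) * d) by field; rewrite gt_eqF.
exact: lim.
Unshelve. all: by end_near. Qed.

End Final.

Theorem corollary1p4 (R : realType) (n : nat) (hn : (1 <= n)%N)
    (pi : hypercube n -> R)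
    (hpi : is_stationary (@hypercube_kernel R n) pi) :
  Ric_ge (@hypercube_kernel R n) pi (2 / n%:R).
Proof.
rewrite (stationary_hypercube hn hpi).
have [unif0 unif1 _] := hypercube_unif_stationary R hn.
apply: (@Ric_ge_hypercube R n hn #|hypercube n|%:R^-1).
  by rewrite invr_ge0 ler0n.
split=> //; rewrite -[RHS]unif1.
by apply: eq_bigr => x _; rewrite mulr1.
Qed.
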